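(* Let $K$ be a field with $\operatorname{char} K\neq 2$, and let $a,b,h$ be positive integers with $1\leq h\leq\min(a,b)$ and $h<\max(a,b)$. Let $X=(x_{ij})$ be an $a\times b$ matrix of independent variables over $K$, and let $I_h(a,b)\subset K[X]=K[x_{ij}: 1\le i\le a,\ 1\le j\le b]$ be the ideal generated by the permanents of all $h\times h$ submatrices of $X$. Then \[ \dim K[X]/I_h(a,b)=\max(a,b)\,(h-1), \] where $\dim$ is Krull dimension. Equivalently, \[ \operatorname{ht} I_h(a,b)=\max(a,b)\bigl(\min(a,b)-h+1\bigr). \]
   Context: The permanent of an $h\times h$ matrix $(m_{ij})$ is $\operatorname{per}(m)=\sum_{\sigma\in S_h}\prod_{i=1}^h m_{i\sigma(i)}$. An $h\times h$ submatrix of $X$ is obtained by choosing $h$ rows and $h$ columns of $X$. *)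

(* Defs.v *)
From HB Require Import structures.
From mathcomp Require Import all_boot all_order all_algebra all_fingroup.
From mathcomp Require Import ring_quotient boolp mpoly.

Set Implicit Arguments.
Unset Strict Implicit.
Unset Printing Implicit Defensive.

Import GRing.Theory.
Local Open Scope ring_scope.

Section Dimension.
Variable R : comNzRingType.

Definition strict_subset (P Q : {pred R}) : Prop :=
  {subset P <= Q} /\ ~ {subset Q <= P}.

(* A chain of n.+1 primes, i.e., a chain of length n. *)
Definition prime_chain (n : nat) (C : 'I_n.+1 -> prime_idealr R) : Prop :=
  forall i j : 'I_n.+1, (i < j)%N -> strict_subset (C i) (C j).

(* krull_dim d: the supremum of the lengths of chains of primes is d. *)
Definition krull_dim (d : nat) : Prop :=
  (exists C : 'I_d.+1 -> prime_idealr R, prime_chain C) /\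
  (forall (n : nat) (C : 'I_n.+1 -> prime_idealr R),
     prime_chain C -> (n <= d)%N).

Definition chain_ending_at (P : prime_idealr R) (n : nat) : Prop :=
  exists C : 'I_n.+1 -> prime_idealr R,
    prime_chain C /\ (C ord_max : {pred R}) =i (P : {pred R}).

Definition prime_height (P : prime_idealr R) (n : nat) : Prop :=
  chain_ending_at P n /\ (forall m : nat, chain_ending_at P m -> (m <= n)%N).

(* ideal_height I n: the infimum of the heights of the primes containing I is
   n (primes of infinite height do not affect this infimum). *)
Definition ideal_height (I : {pred R}) (n : nat) : Prop :=
  (exists P : prime_idealr R,
     {subset I <= (P : {pred R})} /\ prime_height P n) /\
  (forall (P : prime_idealr R) (m : nat),
     {subset I <= (P : {pred R})} -> prime_height P m -> (n <= m)%N).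

Definition ideal_gen (G : R -> Prop) (x : R) : Prop :=
  exists s : seq (R * R),
    (forall cg, cg \in s -> G cg.2) /\ x = \sum_(cg <- s) cg.1 * cg.2.

End Dimension.

Arguments krull_dim R d : clear implicits.

Definition permanent (R : comNzRingType) (n : nat) (A : 'M[R]_n) : R :=
  \sum_(s : 'S_n) \prod_(i < n) A i (s i).

(* The row and column choices f and g are listed in increasing order. *)
Definition subpermanent (R : comNzRingType) (a b h : nat) (A : 'M[R]_(a, b))
    (p : R) : Prop :=
  exists (f : 'I_h -> 'I_a) (g : 'I_h -> 'I_b),
    [/\ forall i j : 'I_h, (i < j)%N -> (f i < f j)%N,
        forall i j : 'I_h, (i < j)%N -> (g i < g j)%N
      & p = permanent (mxsub f g A)].

(* The variables x_ij are numbered by the bijection mxvec_index. *)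
Definition generic_mx (K : fieldType) (a b : nat) :
    'M[{mpoly K[a * b]}]_(a, b) :=
  \matrix_(i < a, j < b) 'X_(mxvec_index i j).

Section PermanentalIdeal.
Variables (K : fieldType) (a b h : nat).

Definition permanental_pred : {pred {mpoly K[a * b]}} :=
  fun p => `[< ideal_gen (subpermanent h (generic_mx K a b)) p >].

Lemma meval0_subpermanent p : (0 < h)%N ->
  subpermanent h (generic_mx K a b) p -> p.@[fun=> 0] = 0.
Proof.
case: h => // h' _ [f [g [_ _ ->]]].
rewrite /permanent raddf_sum big1 //= => s _.
by rewrite rmorph_prod big_ord_recl /= !mxE mevalXU mul0r.
Qed.

Lemma permanental_idealr_closed : (0 < h)%N -> idealr_closed permanental_pred.
Proof.
move=> h_gt0; split.
- by apply/asboolP; exists [::]; split=> //; rewrite big_nil.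
- apply/asboolP=> -[s [sG /(congr1 (meval (fun=> 0)))]].
  rewrite meval1 raddf_sum big_seq big1 => [|cg /sG Gcg] /=.
    by apply/eqP; rewrite oner_eq0.
  by rewrite mevalM (meval0_subpermanent h_gt0 Gcg) mulr0.
- move=> c u v /asboolP [s [sG ->]] /asboolP [t [tG ->]]; apply/asboolP.
  exists ([seq (c * cg.1, cg.2) | cg <- s] ++ t); split.
    by move=> cg; rewrite mem_cat => /orP[/mapP[dg /sG Gdg ->]|/tG].
  rewrite big_cat big_map mulr_sumr; congr (_ + _).
  by apply: eq_bigr => cg _; rewrite mulrA.
Qed.

(* The hypothesis 0 < h makes this ideal proper, as idealr requires. *)
Definition permanental_ideal (h_gt0 : (0 < h)%N) : idealr {mpoly K[a * b]} :=
  HB.pack_for (idealr {mpoly K[a * b]}) (permanental_pred : _ -> bool)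
    (isIdealr.Build _ permanental_pred (permanental_idealr_closed h_gt0)).

End PermanentalIdeal.

Arguments permanental_ideal K a b {h} h_gt0.

(* Main.v *)
From HB Require Import structures.
Require Import Defs.
From mathcomp Require Import all_boot all_order all_algebra all_fingroup.
From mathcomp Require Import ring_quotient boolp mpoly.
From mathcomp Require Import generic_quotient fraction zify ring.
From mathcomp Require classical_sets.

(** Say a <= b. A prime containing the ideal yields a matrix M over its residue
    field whose h-subpermanents vanish, and the heart of the matter is that the
    entries of M have transcendence degree at most b (h - 1), by induction on h.

    Subpermanents are the coefficients of products of rows in the algebra
    generated by e_1, ..., e_b with e_j^2 = 0. Choose a pivot x <> 0 in M, with
    row r and column c, and let f_Q be the product of a set Q of other rows
    with column c removed, and g_Q = \sum_(i in Q) c_i f_(Q - i). Then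
    x f_Q + r g_Q = 0 and r f_Q = 0, hence r^2 g_Q = 0, for |Q| = h - 1, and
    \sum_(i in Q) c_i r g_(Q - i) = 0 for |Q| = h. Let x tend to infinity: with
    respect to a suitable rescaling of rows and columns, 1/x and all other
    entries are homogeneous of positive weight, so that setting 1/x = 0 lowers
    the transcendence degree by at most one. In the limit f_Q = 0 for
    |Q| = h - 1, so induction bounds the entries outside r and c, and the other
    relations (where 2 <> 0 is used) bound the contribution of r and c.

    Transcendence degrees are measured by the growth of spaces of polynomials
    of bounded degree. A prime of coheight at most N in n variables lies on top
    of a chain of length at least n - N, while chains have length at most n;
    the matrices with only h - 1 nonzero rows show that the bound is attained. *)

Set Implicit Arguments.
Unset Strict Implicit.
Unset Printing Implicit Defensive.

Import GRing.Theory.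
Local Open Scope ring_scope.
Local Open Scope quotient_scope.

(** * Growth and transcendence degree *)

Section Growth.
Variables (K L : fieldType) (iota : {rmorphism K -> L}).
Implicit Types (E : L -> Prop) (I : finType).

(** The index is only an upper bound for the degree of a polynomial over [K] in the elements of [E].
    Generating the values inductively avoids enumerating [E], which may be infinite. *)
Inductive pol E : nat -> L -> Prop :=
| pol_const a : pol E 0 (iota a)
| pol_gen x : E x -> pol E 1 x
| pol_add d u v : pol E d u -> pol E d v -> pol E d (u + v)
| pol_mul d d' u v : pol E d u -> pol E d' v -> pol E (d + d') (u * v)
| pol_weak d d' u : (d <= d')%N -> pol E d u -> pol E d' u.

Definition spanned I (g : I -> L) (u : L) : Prop :=
  exists c : I -> K, u = \sum_i iota (c i) * g i.

(* [E] generates an extension of transcendence degree at most [N]. *)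
Definition growth E (N : nat) : Prop :=
  exists C : nat, forall d : nat, exists (I : finType) (g : I -> L),
    (#|I| <= C * d.+1 ^ N)%N /\ forall u, pol E d u -> spanned g u.

Lemma spanned_gen I (g : I -> L) i : spanned g (g i).
Proof.
exists (fun j => (j == i)%:R); rewrite (bigD1 i) //= eqxx rmorph1 mul1r.
by rewrite big1 ?addr0 // => j /negbTE->; rewrite rmorph0 mul0r.
Qed.

Lemma spanned0 I (g : I -> L) : spanned g 0.
Proof. by exists (fun=> 0); rewrite big1 // => j _; rewrite rmorph0 mul0r. Qed.

Lemma spannedD I (g : I -> L) u v :
  spanned g u -> spanned g v -> spanned g (u + v).
Proof.
move=> [c ->] [c' ->]; exists (fun i => c i + c' i).
by rewrite -big_split; apply: eq_bigr => i _; rewrite rmorphD mulrDl.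
Qed.

Lemma spannedZ I (g : I -> L) a u : spanned g u -> spanned g (iota a * u).
Proof.
move=> [c ->]; exists (fun i => a * c i).
by rewrite mulr_sumr; apply: eq_bigr => i _; rewrite rmorphM mulrA.
Qed.

Lemma spanned_sum I (g : I -> L) (T : eqType) (r : seq T) (F : T -> L) :
  (forall t, t \in r -> spanned g (F t)) -> spanned g (\sum_(t <- r) F t).
Proof.
elim: r => [|t r IH] sF; first by rewrite big_nil; apply: spanned0.
rewrite big_cons; apply: spannedD; first by apply: sF; rewrite mem_head.
by apply: IH => t' t'r; apply: sF; rewrite inE t'r orbT.
Qed.

Lemma pol0 E d : pol E d 0.
Proof. by rewrite -(rmorph0 iota); apply: (pol_weak (leq0n d)); constructor. Qed.

Lemma pol1 E d : pol E d 1.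
Proof. by rewrite -(rmorph1 iota); apply: (pol_weak (leq0n d)); constructor. Qed.

Lemma pol_sum E d (T : Type) (r : seq T) (P : pred T) (F : T -> L) :
  (forall t, P t -> pol E d (F t)) -> pol E d (\sum_(t <- r | P t) F t).
Proof. by move=> pF; elim/big_ind: _ => //; [exact: pol0 | exact: pol_add]. Qed.

Lemma polX E d u k : pol E d u -> pol E (d * k) (u ^+ k).
Proof.
move=> pu; elim: k => [|k IH]; first by rewrite expr0; apply: pol1.
by rewrite exprS mulnS; apply: pol_mul.
Qed.

Lemma pol_sub E E' d u : (forall x, E x -> E' x) -> pol E d u -> pol E' d u.
Proof.
move=> sub; elim=> {d u} [a|x /sub|d u v _ IHu _|d d' u v _ IHu _|d d' u le_d _].
- exact: pol_const.
- exact: pol_gen.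
- exact: pol_add.
- exact: pol_mul.
- exact: pol_weak.
Qed.

Lemma growth_sub E E' N : (forall x, E' x -> E x) -> growth E N -> growth E' N.
Proof.
move=> sub [C gC]; exists C => d; have [I [g [cI sg]]] := gC d.
by exists I, g; split=> // u /(pol_sub sub); apply: sg.
Qed.

Lemma growth_none : growth (fun=> False) 0.
Proof.
exists 1%N => d; exists unit, (fun=> 1); rewrite card_unit; split=> // u.
elim=> {d u} [a|//|d u v _ su _ sv|d d' u v _ [c ->] _ sv|//].
- by rewrite -[iota a]mulr1; apply/spannedZ/(spanned_gen _ tt).
- exact: spannedD.
- rewrite (bigD1 tt) //= [X in _ + X]big1 => [|[]//].
  by rewrite addr0 mulr1; apply: spannedZ.
Qed.

Lemma growth_leq E N N' : (N <= N')%N -> growth E N -> growth E N'.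
Proof.
move=> leN [C gC]; exists C => d; have [I [g [cI sg]]] := gC d.
exists I, g; split=> //; apply: leq_trans cI _.
by rewrite leq_mul2l leq_pexp2l ?orbT.
Qed.

(* Write a polynomial in [E] and [t] as a univariate polynomial in [t]. *)
Lemma growth_adjoin E N t : growth E N -> growth (fun x => E x \/ x = t) N.+1.
Proof.
move=> [C gC]; exists C => d; have [I [g [cI sg]]] := gC d.
exists ('I_d.+1 * I)%type, (fun p : 'I_d.+1 * I => t ^+ p.1 * g p.2).
split; first by rewrite card_prod card_ord expnS mulnCA leq_mul2l cI orbT.
move=> u pu; have [q [sq pq ->]] : exists q : {poly L},
    [/\ (size q <= d.+1)%N, forall i, pol E d q`_i & u = q.[t]].
  elim: pu => {u d I g cI sg}.
  - move=> a; exists (iota a)%:P; rewrite size_polyC hornerC.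
    split=> //; first by case: (_ != _).
    by move=> i; rewrite coefC; case: eqP => _; [constructor|exact: pol0].
  - move=> x [Ex|->].
      exists x%:P; rewrite size_polyC hornerC; split=> //; first by case: (_ != _).
      by move=> i; rewrite coefC; case: eqP => _; [constructor|exact: pol0].
    exists 'X; rewrite size_polyX hornerX; split=> // i.
    by rewrite coefX; case: (_ == _); [exact: pol1|exact: pol0].
  - move=> d u v _ [p [sp pp ->]] _ [q [sq pq ->]]; exists (p + q).
    rewrite hornerD; split=> //.
      by apply: leq_trans (size_polyD _ _) _; rewrite geq_max sp.
    by move=> i; rewrite coefD; apply: pol_add.
  - move=> d d' u v _ [p [sp pp ->]] _ [q [sq pq ->]]; exists (p * q).
    rewrite hornerM; split=> //.
      by apply: leq_trans (size_polyMleq _ _) _; lia.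
    by move=> i; rewrite coefM; apply: pol_sum => j _; apply: pol_mul.
  - move=> d d' u le_d _ [p [sp pp ->]]; exists p; split=> //.
      exact: leq_trans sp _.
    by move=> i; apply: (pol_weak le_d).
rewrite (horner_coef_wide t sq).
apply: spanned_sum => i _; have [c ->] := sg _ (pq i).
rewrite mulr_suml; apply: spanned_sum => j _; rewrite -mulrA [g j * _]mulrC.
by apply: spannedZ; apply: (spanned_gen (fun p : 'I_d.+1 * I => t ^+ p.1 * g p.2) (i, j)).
Qed.

Lemma growth_adjoins E N (ts : seq L) :
  growth E N -> growth (fun x => E x \/ x \in ts) (N + size ts).
Proof.
elim: ts E N => [|t ts IH] E N gE.
  by rewrite addn0; apply: growth_sub gE => x [].
rewrite addnS -addSn; apply: growth_sub (IH _ _ (growth_adjoin t gE)) => x.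
by rewrite inE; case=> [Ex|/orP[/eqP->|tx]]; auto.
Qed.

(** This is the subfield [K(E)] of [L], with [q] as a denominator of [u]. *)
Definition infield E (u : L) : Prop :=
  exists d q, [/\ q != 0, pol E d q & pol E d (q * u)].

Lemma infield_gen E x : E x -> infield E x.
Proof.
move=> Ex; exists 1%N, 1; rewrite oner_eq0 mul1r; split=> //.
  exact: pol1.
exact: pol_gen.
Qed.

Lemma infield_nat E k : infield E k%:R.
Proof.
exists 0%N, 1; rewrite oner_eq0 mul1r; split=> //; first exact: pol1.
by rewrite -(rmorph_nat iota); constructor.
Qed.

Lemma infield0 E : infield E 0.
Proof. exact: (infield_nat E 0). Qed.

Lemma infieldM E u v : infield E u -> infield E v -> infield E (u * v).
Proof.
move=> [d [q [q0 pq pu]]] [d' [q' [q'0 pq' pv]]].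
exists (d + d')%N, (q * q'); rewrite mulf_neq0 // mulrACA.
by split=> //; apply: pol_mul.
Qed.

Lemma infieldD E u v : infield E u -> infield E v -> infield E (u + v).
Proof.
move=> [d [q [q0 pq pu]]] [d' [q' [q'0 pq' pv]]].
exists (d + d')%N, (q * q'); rewrite mulf_neq0 //; split=> //.
  exact: pol_mul.
rewrite (_ : q * q' * (u + v) = q * u * q' + q * (q' * v)); last by ring.
by apply: pol_add; apply: pol_mul.
Qed.

Lemma infieldN E u : infield E u -> infield E (- u).
Proof.
move=> iu; rewrite -mulN1r -(rmorph1 iota) -rmorphN; apply: infieldM iu.
exists 0%N, 1; rewrite oner_eq0 mul1r; split=> //; first exact: pol1.
exact: pol_const.
Qed.

Lemma infieldV E u : infield E u -> infield E u^-1.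
Proof.
move=> [d [q [q0 pq pu]]]; have [->|u0] := eqVneq u 0.
  by rewrite invr0; apply: infield0.
by exists d, (q * u); rewrite mulf_neq0 // mulfK.
Qed.

Lemma infield_sum E (T : Type) (r : seq T) (P : pred T) (F : T -> L) :
  (forall t, P t -> infield E (F t)) -> infield E (\sum_(t <- r | P t) F t).
Proof.
by move=> pF; elim/big_ind: _ => //; [exact: infield0 | exact: infieldD].
Qed.

(** If [q] is a common denominator of [s], of degree [D], then [q ^+ d] clears the denominators of
    all polynomials of degree [d] in [s]. A spanning family for degree [D * d] in [E], divided by
    [q ^+ d], therefore suffices, and its size changes by a constant factor only. *)
Lemma growth_infield E N (s : seq L) :
  growth E N -> (forall x, x \in s -> infield E x) ->
  growth (fun x => x \in s) N.
Proof.
move=> [C gC] inf.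
have [D [q [q0 pq pqs]]] : exists D q, [/\ q != 0, pol E D q &
    forall x, x \in s -> pol E D (q * x)].
  elim: s inf => [|x s IH] inf.
    by exists 0%N, 1; rewrite oner_eq0; split=> //; apply: pol1.
  have [y ys|D [q [q0 pq pqs]]] := IH; first by apply: inf; rewrite inE ys orbT.
  have [D' [q' [q'0 pq' pq'x]]] := inf x (mem_head _ _).
  exists (D + D')%N, (q * q'); rewrite mulf_neq0 //; split=> //.
    exact: pol_mul.
  move=> y; rewrite inE => /orP[/eqP->|ys].
    by rewrite -mulrA; apply: pol_mul.
  by rewrite mulrAC; apply: pol_mul => //; apply: pqs.
exists (C * D.+1 ^ N)%N => d; have [I [g [cI sg]]] := gC (D * d)%N.
exists I, (fun i => g i / q ^+ d); split.
  apply: leq_trans cI _; rewrite -mulnA leq_mul2l -expnMn; apply/orP; right.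
  by case: (N) => [|k]; rewrite ?expn0 // leq_exp2r //; nia.
move=> u pu; have : pol E (D * d) (q ^+ d * u).
  elim: pu => {u d I g cI sg}.
  - by move=> a; rewrite muln0 expr0 mul1r; constructor.
  - by move=> x xs; rewrite muln1 expr1; apply: pqs.
  - by move=> d u v _ pu _ pv; rewrite mulrDr; apply: pol_add.
  - move=> d d' u v _ pu _ pv; rewrite mulnDr exprD mulrACA.
    exact: pol_mul.
  - move=> d d' u le_d _ pu; rewrite -(subnK le_d) mulnDr exprD -mulrA.
    by apply: pol_mul => //; apply: polX.
move=> /sg [c uE]; exists c.
rewrite -[u](mulKf (expf_neq0 d q0)) uE mulr_sumr.
by apply: eq_bigr => i _; rewrite mulrC mulrA.
Qed.

End Growth.

(** * Algebraic dependence forced by slow growth *)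

Definition involves (n : nat) (R : nzRingType) (S : {set 'I_n})
    (p : {mpoly R[n]}) : Prop :=
  forall m, m \in msupp p -> forall i, i \notin S -> m i = 0%N.

Section Dependence.
Variables (K L : fieldType) (iota : {rmorphism K -> L}).

(** The matrix of coordinates has more rows than columns, hence a nonzero left kernel. *)
Lemma spanned_dependent (I T : finType) (g : I -> L) (v : T -> L) :
  (#|I| < #|T|)%N -> (forall t, spanned iota g (v t)) ->
  exists c : T -> K, (exists t, c t != 0) /\ \sum_t iota (c t) * v t = 0.
Proof.
move=> ltIT sv; have [f vE] := choice sv.
pose A : 'M[K]_(#|T|, #|I|) := \matrix_(t, i) f (enum_val t) (enum_val i).
pose u := nz_row (kermx A).
have u0 : u != 0.
  rewrite nz_row_eq0 -mxrank_eq0 mxrank_ker -lt0n subn_gt0.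
  exact: leq_ltn_trans (rank_leq_col A) ltIT.
have uA : u *m A = 0 by apply/sub_kermxP/nz_row_sub.
exists (fun t => u 0 (enum_rank t)); split.
  have [j uj] : exists j, u 0 j != 0.
    apply: contrapT => nu; case/eqP: u0; apply/rowP => j; rewrite mxE.
    by apply/eqP; apply: contrapT => /negP uj; apply: nu; exists j.
  by exists (enum_val j); rewrite enum_valK.
rewrite (eq_bigr (fun t => \sum_i iota (u 0 (enum_rank t) * f t i) * g i)).
  rewrite exchange_big big1 //= => i _; rewrite -mulr_suml -rmorph_sum.
  have /rowP/(_ (enum_rank i)) := uA; rewrite !mxE => uAi.
  rewrite (reindex (@enum_val T predT)) /=; last first.
    by exists enum_rank => x _; rewrite ?enum_valK ?enum_rankK.
  rewrite (eq_bigr (fun j => u 0 j * A j (enum_rank i))) ?uAi ?rmorph0 ?mul0r //.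
  by move=> j _; rewrite enum_valK mxE enum_rankK.
move=> t _; rewrite vE mulr_sumr; apply: eq_bigr => i _.
by rewrite rmorphM mulrA.
Qed.

Lemma pol_mmap1 (E : L -> Prop) n (y : 'I_n -> L) (m : 'X_{1..n}) :
  (forall i, (0 < m i)%N -> E (y i)) -> pol iota E (mdeg m) (mmap1 y m).
Proof.
move=> Ey; rewrite mdegE /mmap1; apply: (big_ind2 (fun d u => pol iota E d u)).
- exact: pol1.
- by move=> *; apply: pol_mul.
- move=> i _; have [->|m0] := posnP (m i); first by rewrite expr0; apply: pol1.
  by rewrite -[X in pol _ _ X]mul1n; apply: polX; apply: pol_gen; apply: Ey.
Qed.

(** The [s.+1 ^ k] monomials in the variables of [S] with exponents at most [s] have degree at most
    [k * s], and they outnumber the spanning family for that degree. *)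
Lemma growth_dependent (E : L -> Prop) N n (y : 'I_n -> L) (S : {set 'I_n}) :
  growth iota E N -> (N < #|S|)%N -> (forall i, i \in S -> E (y i)) ->
  exists p : {mpoly K[n]}, [/\ p != 0, involves S p & mmap iota y p = 0].
Proof.
(* This [s] gives [C * (k * s).+1 ^ N <= s * s.+1 ^ N < s.+1 ^ N.+1 <= s.+1 ^ k]. *)
move=> [C gC] ltN Ey; set k := #|S|; pose s := (C * k.+1 ^ N)%N.
have [I [g [cI sg]]] := gC (k * s)%N.
pose T := {ffun 'I_k -> 'I_s.+1}.
pose mT (e : T) : 'X_{1..n} :=
  [multinom (if [pick j : 'I_k | enum_val j == i] is Some j then e j : nat
             else 0%N) | i < n].
have mTE e (j : 'I_k) : mT e (enum_val j) = e j.
  rewrite mnmE; case: pickP => [j' /eqP/enum_val_inj-> //|/(_ j)].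
  by rewrite eqxx.
have mT_inj : injective mT.
  move=> e e' /mnmP mm; apply/ffunP => j; apply: val_inj.
  by rewrite /= -!mTE mm.
have mTS e i : i \notin S -> mT e i = 0%N.
  move=> iS; rewrite mnmE; case: pickP => // j /eqP ji.
  by case/negP: iS; rewrite -ji enum_valP.
have mTdeg e : (mdeg (mT e) <= k * s)%N.
  rewrite mdegE (bigID (mem S)) /= [X in (_ + X)%N]big1 ?addn0; last first.
    by move=> i /mTS.
  rewrite -sum_nat_const; apply: leq_sum => i iS.
  have [j ->] : exists j : 'I_k, i = enum_val j.
    by exists (enum_rank_in iS i); rewrite enum_rankK_in.
  by rewrite mTE -ltnS.
have ltIT : (#|I| < #|T|)%N.
  apply: leq_ltn_trans cI _; rewrite card_ffun !card_ord.
  apply: (@leq_trans (s.+1 ^ N.+1)); last by rewrite leq_pexp2l.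
  rewrite expnS (@leq_ltn_trans (s * s.+1 ^ N)%N) ?ltn_pmul2r ?expn_gt0 //.
  rewrite /s -mulnA leq_mul2l -expnMn; apply/orP; right.
  by case: (N) => [|N']; rewrite ?expn0 // leq_exp2r //; nia.
have [e|c [[e0 ce0] cE]] := @spanned_dependent I T g (fun e => mmap1 y (mT e)) ltIT.
  apply/sg/(pol_weak (mTdeg e))/pol_mmap1 => i; rewrite lt0n => mi.
  by apply: Ey; apply: contraNT mi => /(mTS e)->.
exists (\sum_e c e *: 'X_[mT e]); split.
- apply/eqP => /(congr1 (mcoeff (mT e0))); rewrite raddf_sum mcoeff0 (bigD1 e0) //=.
  rewrite mcoeffZ mcoeffX eqxx mulr1 big1 ?addr0 => [|e ne]; first exact/eqP.
  by rewrite mcoeffZ mcoeffX (inj_eq mT_inj) (negbTE ne) mulr0.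
- move=> m; rewrite mcoeff_msupp raddf_sum /= => m0 i iS.
  apply: contraNeq m0 => mi; rewrite big1 // => e _.
  rewrite mcoeffZ mcoeffX; case: eqP => [me|_]; last by rewrite mulr0.
  by rewrite -me mTS in mi.
- rewrite raddf_sum -[RHS]cE; apply: eq_bigr => e _ /=.
  by rewrite mmapZ mmapX.
Qed.
End Dependence.

(** * Primes and residue fields *)

Section PrimeQuotient.
Variables (R : comNzRingType) (P : prime_idealr R).

(** A separate name for the quotient ring carries the inverse chosen classically below, and with it
    the integral domain structure from which the fraction field is built. *)
Definition prime_quot : Type := {ideal_quot P}.
HB.instance Definition _ := GRing.ComNzRing.on prime_quot.

Definition pq_unit : {pred prime_quot} := fun x => `[< exists y, y * x = 1 >].

Definition pq_inv (x : prime_quot) : prime_quot :=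
  if pselect (exists y, y * x = 1) is left e then projT1 (cid e) else x.

Lemma pq_mulVr : {in pq_unit, left_inverse 1 pq_inv *%R}.
Proof.
move=> x /asboolP ux; rewrite /pq_inv; case: pselect => // e.
exact: (projT2 (cid e)).
Qed.

Lemma pq_unitP (x y : prime_quot) : y * x = 1 -> x \in pq_unit.
Proof. by move=> yx; apply/asboolP; exists y. Qed.

Lemma pq_inv_out : {in [predC pq_unit], pq_inv =1 id}.
Proof.
by move=> x; rewrite inE => /asboolP nu; rewrite /pq_inv; case: pselect.
Qed.

HB.instance Definition _ := GRing.ComNzRing_hasMulInverse.Build prime_quot
  pq_mulVr pq_unitP pq_inv_out.
HB.instance Definition _ := GRing.ComUnitRing_isIntegral.Build prime_quot
  (@Quotient.rquot_IdomainAxiom R P).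

Definition residue_field : fieldType := {fraction prime_quot}.
Definition residue : {rmorphism R -> residue_field} :=
  (@FracField.tofrac prime_quot) \o (\pi_({ideal_quot P}) : R -> prime_quot).

Lemma residue_eq0 p : (residue p == 0) = (p \in P).
Proof.
rewrite /= tofrac_eq0 -[p in RHS]subr0 Quotient.idealrBE.
by rewrite (rmorph0 (\pi_({ideal_quot P}))).
Qed.
End PrimeQuotient.

Lemma prime_idealr_of (R : comNzRingType) (S : R -> bool) :
  idealr_closed S -> (forall u v, S (u * v) -> S u || S v) ->
  exists P : prime_idealr R, (P : {pred R}) =i S.
Proof.
move=> idS prS.
by exists (HB.pack_for (prime_idealr R) S (isIdealr.Build _ S idS)
             (isPrimeIdealrClosed.Build _ S prS)).
Qed.

(** By Zorn's lemma there is an ideal containing [J] that is maximal among those disjoint from the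
    multiplicative set [M]; such an ideal is prime. *)
Lemma prime_avoiding (R : comNzRingType) (J M : R -> Prop) :
  J 0 -> (forall u v, J u -> J v -> J (u + v)) -> (forall c u, J u -> J (c * u)) ->
  M 1 -> (forall u v, M u -> M v -> M (u * v)) -> (forall u, J u -> ~ M u) ->
  exists P : prime_idealr R, (forall u, J u -> u \in P) /\ (forall u, M u -> u \notin P).
Proof.
move=> J0 JD JM M1 MM JnM.
pose ideal (A : R -> Prop) := [/\ (forall u v, A u -> A v -> A (u + v)),
  (forall c u, A u -> A (c * u)) & forall u, A u -> ~ M u].
(* The union with [J] makes the empty chain admissible too, although its own union is empty. *)
pose Q (A : R -> Prop) := ideal (fun u => J u \/ A u).
have [|A [[AD AM AnM] Amax]] := @classical_sets.Zorn_bigcup R Q.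
  move=> F FQ Ftot.
  split.
  - move=> u v [Ju|[X FX Xu]] [Jv|[Y FY Yv]].
    + by left; apply: JD.
    + have [D _ _] := FQ _ FY; have [] := D u v; auto.
      by move=> Yuv; right; exists Y.
    + have [D _ _] := FQ _ FX; have [] := D u v; auto.
      by move=> Xuv; right; exists X.
    + have [XY|YX] := Ftot _ _ FX FY.
        have [D _ _] := FQ _ FY; have [] := D u v; auto.
        by move=> Yuv; right; exists Y.
      have [D _ _] := FQ _ FX; have [] := D u v; auto.
      by move=> Xuv; right; exists X.
  - move=> c u [Ju|[X FX Xu]]; first by left; apply: JM.
    have [_ D _] := FQ _ FX; have [] := D c u; auto.
    by move=> Xcu; right; exists X.
  - move=> u [Ju|[X FX Xu]]; first exact: JnM.
    by have [_ _ D] := FQ _ FX; apply: D; right.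
pose B u := J u \/ A u.
have B0 : B 0 by left.
(* By maximality, [B + (u)] meets [M] whenever [u] is not in [B]. *)
have hit u : ~ B u -> exists c b, B b /\ M (b + c * u).
  move=> nBu; apply: contrapT => nh.
  pose A' v := exists c b, B b /\ v = b + c * u.
  have BA' v : B v -> A' v by exists 0, v; rewrite mul0r addr0.
  apply: (Amax A'); first split.
  - by move=> v Av; apply: BA'; right.
  - move=> sub; apply: nBu; right; apply: sub.
    by exists 1, 0; rewrite add0r mul1r.
  have JA' v : J v \/ A' v <-> A' v by split; [case=> // Jv; apply: BA'; left|right].
  split.
  - move=> v w /JA' [c [b [Bb ->]]] /JA' [c' [b' [Bb' ->]]]; apply/JA'.
    by exists (c + c'), (b + b'); split; [exact: AD|rewrite mulrDl addrACA].
  - move=> c v /JA' [c' [b [Bb ->]]]; apply/JA'; exists (c * c'), (c * b).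
    by split; [exact: AM|rewrite mulrDr mulrA].
  - by move=> v /JA' [c [b [Bb ->]]] Mv; apply: nh; exists c, b.
have [||P PE] := @prime_idealr_of R (fun u => `[< B u >]).
- split; first by apply/asboolP.
    by apply/asboolP => /AnM; apply.
  by move=> c u v /asboolP Bu /asboolP Bv; apply/asboolP/AD => //; apply: AM.
- move=> u v /asboolP Buv; apply/orP; apply: contrapT => nuv.
  have [nu nv] : ~ B u /\ ~ B v.
    by split=> h; apply: nuv; [left|right]; apply/asboolP.
  have [c [b [Bb Mb]]] := hit _ nu; have [c' [b' [Bb' Mb']]] := hit _ nv.
  apply: (AnM _ _ (MM _ _ Mb Mb')).
  rewrite (_ : (b + c * u) * (b' + c' * v) =
    (b' + c' * v) * b + (c * u * b' + c * c' * (u * v))); last by ring.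
  by apply: (AD) => //; [exact: AM|apply: (AD); exact: AM].
exists P; split=> u; rewrite PE => hu; first by apply/asboolP; left.
by apply/asboolP => /AnM; apply.
Qed.

(** * Homogeneous specialization *)

Section Weights.
Variables (n : nat) (w : 'I_n -> nat).

Definition weight (m : 'X_{1..n}) : nat := (\sum_i m i * w i)%N.

Lemma weightD m1 m2 : weight (m1 + m2)%MM = (weight m1 + weight m2)%N.
Proof.
by rewrite /weight -big_split; apply: eq_bigr => i _; rewrite mnmDE mulnDl.
Qed.

Lemma weight_leq m : (weight m <= mdeg m * \sum_i w i)%N.
Proof.
rewrite mdegE big_distrl; apply: leq_sum => i _ /=.
by rewrite leq_mul2l (bigD1 i) //= leq_addr orbT.
Qed.

Lemma leq_weight (m : 'X_{1..n}) i : (0 < w i)%N -> (m i <= weight m)%N.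
Proof.
move=> wi; apply: (@leq_trans (m i * w i)); first by rewrite leq_pmulr.
by rewrite /weight (bigD1 i) //= leq_addr.
Qed.

Definition weight_comp (R : nzRingType) k (p : {mpoly R[n]}) : {mpoly R[n]} :=
  \sum_(m <- msupp p | weight m == k) p@_m *: 'X_[m].

Lemma weight_compE (R : nzRingType) k (p : {mpoly R[n]}) m :
  (weight_comp k p)@_m = if weight m == k then p@_m else 0.
Proof.
rewrite raddf_sum /=; under eq_bigr => m' _ do rewrite mcoeffZ mcoeffX.
case: ifP => [wm|wm].
  rewrite [p in RHS]mpolyE raddf_sum /= big_mkcond /=; apply: eq_bigr => m' _.
  rewrite mcoeffZ mcoeffX; case: (m' =P m) => [->|_]; first by rewrite wm.
  by rewrite mulr0; case: ifP.
rewrite big1 // => m' /eqP wm'; case: (m' =P m) => [mm'|_]; last by rewrite mulr0.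
by rewrite -mm' wm' eqxx in wm.
Qed.

Lemma weight_comp_supp (R : nzRingType) k (p : {mpoly R[n]}) m :
  m \in msupp (weight_comp k p) -> weight m = k /\ m \in msupp p.
Proof.
rewrite mcoeff_msupp weight_compE; case: ifP => [/eqP wm|_]; last by rewrite eqxx.
by rewrite mcoeff_msupp.
Qed.

(* The substitution [Y_i := y_i t^(w i)], whose kernel is the ideal of the
   weighted homogeneous relations among the [y_i]. *)
Definition weighted_eval (K L : fieldType) (iota : {rmorphism K -> L})
    (y : 'I_n -> L) : {rmorphism {mpoly K[n]} -> {poly L}} :=
  mmap (polyC \o iota) (fun i => y i *: 'X^(w i)).

Lemma coef_weighted_eval (K L : fieldType) (iota : {rmorphism K -> L})
    (y : 'I_n -> L) (p : {mpoly K[n]}) k :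
  (weighted_eval iota y p)`_k = mmap iota y (weight_comp k p).
Proof.
have mE m : mmap1 (fun i => y i *: 'X^(w i)) m = mmap1 y m *: 'X^(weight m).
  rewrite /mmap1 /weight; elim/big_rec3: _ => [|i c a b _ ->].
    by rewrite scale1r.
  rewrite exprZn -exprM [(w i * m i)%N]mulnC exprD -scalerAl -scalerAr scalerA.
  by [].
rewrite /= /mmap coef_sum [RHS]/= -/(mmap iota y (weight_comp k p)).
rewrite [in RHS]raddf_sum /= [RHS]big_mkcond; apply: eq_bigr => m _.
rewrite mE coefCM coefZ coefXn eq_sym; case: eqP => _; last by rewrite !mulr0.
by rewrite mmapZ mmapX mulr1.
Qed.

End Weights.

Section Specialization.
Variables (K L : fieldType) (iota : {rmorphism K -> L}).
Variables (n : nat) (y : 'I_n -> L) (w : 'I_n -> nat) (z : 'I_n) (N : nat).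
Hypothesis w_gt0 : forall i, (0 < w i)%N.

Let ev := mmap iota y.
Let wt := weight w.

Lemma pol_range d u : pol iota (fun v => exists i, v = y i) d u ->
  exists p : {mpoly K[n]}, ev p = u /\ forall m, m \in msupp p -> (mdeg m <= d)%N.
Proof.
elim=> {d u} [a|_ [i ->]|d u v _ [p [<- dp]] _ [q [<- dq]]
    |d d' u v _ [p [<- dp]] _ [q [<- dq]]|d d' u le_d _ [p [<- dp]]].
- exists a%:MP; split; first exact: mmapC.
  by move=> m; rewrite msuppC; case: ifP => // _; rewrite inE => /eqP->; rewrite mdeg0.
- exists 'X_i; split; first by rewrite /ev mmapX mmap1U.
  by move=> m; rewrite msuppX inE => /eqP->; rewrite mdeg1.
- exists (p + q); split; first exact: mmapD.
  by move=> m /msuppD_le; rewrite mem_cat => /orP[/dp|/dq].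
- exists (p * q); split; first exact: rmorphM.
  move=> m /msuppM_le /allpairsP[[m1 m2] /= [/dp d1 /dq d2 ->]].
  by rewrite mdegD leq_add.
- by exists p; split=> // m /dp /leq_trans; apply.
Qed.

(* [g] is [z h] up to a relation: the leading monomial of [g] can be rewritten
   modulo [z], without raising the weight. *)
Definition rewrites (g h : {mpoly K[n]}) : Prop :=
  [/\ g != 0,
      (forall m, m \in msupp g -> wt m = wt (mlead g)),
      (forall m, m \in msupp h -> (wt m < wt (mlead g))%N)
    & ev g = y z * ev h].

(** Compare the coefficients of [t^k] in the hypothesis, for [k] the weight of the leading monomial
    of [f]. The right side contributes [y z] times the component of [q] of weight [k - w z], or
    nothing if [k < w z]. *)
Lemma rewrites_exists (f q : {mpoly K[n]}) (S : {set 'I_n}) :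
  f != 0 -> involves S f ->
  weighted_eval w iota y f = weighted_eval w iota y ('X_z * q) ->
  exists g h, rewrites g h /\ involves S g.
Proof.
move=> f0 fS fE; pose k := wt (mlead f); pose g := weight_comp w k f.
have g0 : g != 0.
  apply/eqP => /(congr1 (mcoeff (mlead f))); rewrite weight_compE eqxx mcoeff0.
  by apply/eqP; rewrite -mcoeff_msupp mlead_supp.
have gS m : m \in msupp g -> wt m = k by move=> /weight_comp_supp[].
have gk : wt (mlead g) = k by apply: gS; apply: mlead_supp.
exists g, (if (k < w z)%N then 0 else weight_comp w (k - w z)%N q); split; last first.
  by move=> m /weight_comp_supp[_]; apply: fS.
split=> // [m mg|m|]; first by rewrite gk; apply: gS.
  case: ifP => [_|/negbT]; first by rewrite mcoeff_msupp mcoeff0 eqxx.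
  rewrite -leqNgt => wk /weight_comp_supp[wm _]; rewrite gk /wt wm.
  by rewrite ltn_subrL w_gt0 (leq_trans (w_gt0 z)).
rewrite /ev -coef_weighted_eval fE rmorphM /= mmapX mmap1U -scalerAl coefZ coefXnM.
case: ifP => _; first by rewrite mmap0.
by rewrite -coef_weighted_eval.
Qed.

Variables (B : nat).

Definition reduced (m : 'X_{1..n}) : bool := (#|[set i | (B <= m i)%N]| <= N)%N.

(** A factor [y z] counts 1 whatever [w z] is: a rewriting step gains one such factor and lowers the
    weight by at least 1. *)
Definition reducible_to k (u : L) : Prop :=
  exists s : seq (K * (nat * 'X_{1..n})),
    (forall t, t \in s -> (t.2.1 + wt t.2.2 <= k)%N /\ reduced t.2.2) /\
    u = \sum_(t <- s) iota t.1 * (y z ^+ t.2.1 * mmap1 y t.2.2).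

Lemma reducible0 k : reducible_to k 0.
Proof. by exists [::]; rewrite big_nil. Qed.

Lemma reducibleD k u v :
  reducible_to k u -> reducible_to k v -> reducible_to k (u + v).
Proof.
move=> [s [sP ->]] [s' [s'P ->]]; exists (s ++ s'); rewrite big_cat; split=> // t.
by rewrite mem_cat => /orP[/sP|/s'P].
Qed.

Lemma reducibleZ k a u : reducible_to k u -> reducible_to k (iota a * u).
Proof.
move=> [s [sP ->]]; exists [seq (a * t.1, t.2) | t <- s]; split.
  by move=> _ /mapP[t /sP ts ->].
by rewrite big_map mulr_sumr; apply: eq_bigr => t _; rewrite rmorphM mulrA.
Qed.

Lemma reducible_sum k (T : eqType) (r : seq T) (F : T -> L) :
  (forall t, t \in r -> reducible_to k (F t)) ->
  reducible_to k (\sum_(t <- r) F t).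
Proof.
elim: r => [|t r IH] rF; first by rewrite big_nil; apply: reducible0.
rewrite big_cons; apply: reducibleD; first by apply: rF; rewrite mem_head.
by apply: IH => t' t'r; apply: rF; rewrite inE t'r orbT.
Qed.

Lemma reducible_shift k k' u :
  (k < k')%N -> reducible_to k u -> reducible_to k' (y z * u).
Proof.
move=> kk' [s [sP ->]]; exists [seq (t.1, (t.2.1.+1, t.2.2)) | t <- s]; split.
  by move=> _ /mapP[t /sP [ts rt] ->]; split=> //=; apply: leq_trans kk'.
rewrite big_map mulr_sumr; apply: eq_bigr => t _ /=.
by rewrite exprS mulrCA -!mulrA.
Qed.

(** Induction on the weight, then on the monomial order. A monomial that is not reduced has [N.+1]
    exponents of size at least [B], so it is divisible by the leading monomial of the corresponding
    [g]. Rewriting leaves smaller monomials of the same weight, and [y z] times monomials of lower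
    weight. *)
Lemma monomial_reducible :
  (forall S : {set 'I_n}, #|S| = N.+1 -> exists g h,
     [/\ rewrites g h, involves S g & (mdeg (mlead g) < B)%N]) ->
  forall m, reducible_to (wt m) (mmap1 y m).
Proof.
move=> rwS m; have [k] := ubnP (wt m); elim: k m => // k IHk m.
elim/(@ltmwf n): m => m IHm; rewrite ltnS => wmk.
have [rm|nrm] := boolP (reduced m).
  exists [:: (1, (0%N, m))]; split; first by move=> t; rewrite inE => /eqP->.
  by rewrite big_seq1 rmorph1 mul1r expr0 mul1r.
pose S0 := [set i | (B <= m i)%N].
pose S := [set i in take N.+1 (enum S0)].
have szt : size (take N.+1 (enum S0)) = N.+1.
  by rewrite size_takel // -cardE ltnNge.
have cS : #|S| = N.+1.
  by rewrite cardsE (card_uniqP _) // take_uniq ?enum_uniq.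
have SS0 i : i \in S -> (B <= m i)%N.
  by rewrite inE => /mem_take; rewrite mem_enum inE.
have [g [h [[g0 gw hw gh] gS gB]]] := rwS S cS.
set a := mlead g in gw hw gB.
have lea : (a <= m)%MM.
  apply/mnm_lepP => i; have [iS|iS] := boolP (i \in S).
    apply: leq_trans (SS0 i iS); apply: leq_trans (ltnW gB).
    by rewrite mdegE (bigD1 i) //= leq_addr.
  by rewrite (gS a (mlead_supp g0) i iS).
pose e := (m - a)%MM; have mE : m = (a + e)%MM by rewrite addmC submK.
have wmE : wt m = (wt a + wt e)%N by rewrite {1}mE /wt weightD.
have lc0 : mleadc g != 0 by rewrite mleadc_eq0.
have evE p : ev p * mmap1 y e = \sum_(m' <- msupp p) iota p@_m' * mmap1 y (m' + e)%MM.
  rewrite /ev /mmap mulr_suml; apply: eq_bigr => m' _.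
  by rewrite -mulrA -commr_mmap1_M // => i x; apply: mulrC.
have key : mmap1 y m = iota (mleadc g)^-1 * (y z * (ev h * mmap1 y e) +
    iota (-1) * \sum_(m' <- rem a (msupp g)) iota g@_m' * mmap1 y (m' + e)%MM).
  rewrite mulrA -gh evE (perm_big _ (perm_to_rem (mlead_supp g0))) big_cons.
  rewrite -/a -mE rmorphN1 mulN1r addrK mulrA -rmorphM mulVf // rmorph1.
  by rewrite mul1r.
rewrite key; apply/reducibleZ/reducibleD.
  case: (posnP (wt m)) => [wm0|wm_gt0].
    have -> : h = 0.
      apply/eqP; rewrite -msupp_eq0; case: (msupp h) hw => // m' s.
      by move=> /(_ m' (mem_head _ _)); lia.
    by rewrite /ev mmap0 mul0r mulr0; apply: reducible0.
  rewrite evE mulr_sumr; apply: reducible_sum => m' m'h.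
  have lt' : (wt (m' + e)%MM < wt m)%N.
    by rewrite wmE /wt weightD ltn_add2r; apply: hw.
  rewrite mulrCA; apply/reducibleZ/(reducible_shift lt')/IHk.
  exact: leq_trans lt' wmk.
apply/reducibleZ/reducible_sum => m' m'g; apply: reducibleZ.
move: m'g; rewrite mem_rem_uniq ?msupp_uniq // inE => /andP[m'a m'g].
have wm' : wt (m' + e)%MM = wt m by rewrite wmE /wt weightD -/wt gw.
rewrite -wm'; apply: IHm; last by rewrite wm' ltnS.
rewrite [in X in (_ < X)%O]mE ltmc_add2l Order.POrderTheory.lt_neqAle m'a.
exact: msupp_le_mlead.
Qed.

End Specialization.

(** A term is described by the power of [y z], the exponents below [B], and the places and values of
    at most [N] large exponents. Only [N.+1] of these data grow with [k], and each is at most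
    [k]. *)
Lemma reducible_spanned (K L : fieldType) (iota : {rmorphism K -> L}) n
    (y : 'I_n -> L) (w : 'I_n -> nat) (z : 'I_n) (N B k : nat) :
  (forall i, (0 < w i)%N) ->
  exists (I : finType) (g : I -> L),
    (#|I| <= B.+1 ^ n * n ^ N * k.+1 ^ N.+1)%N /\
    forall u, reducible_to iota y w z N B k u -> spanned iota g u.
Proof.
move=> w_gt0.
pose I := ('I_k.+1 * {ffun 'I_n -> 'I_B.+1} * {ffun 'I_N -> 'I_n} *
           {ffun 'I_N -> 'I_k.+1})%type.
pose g (p : I) := y z ^+ p.1.1.1 * (\prod_i y i ^+ p.1.1.2 i *
                     \prod_i y (p.1.2 i) ^+ p.2 i).
exists I, g; split.
  rewrite !card_prod !card_ffun !card_ord expnS; apply: eq_leq; ring.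
move=> _ [s [sP ->]]; apply: spanned_sum => t /sP []; case: t => c [i m] /=.
move=> wtk rm; apply: spannedZ.
pose bs := [seq j <- enum 'I_n | (B <= m j)%N].
have szbs : (size bs <= N)%N.
  by move: rm; rewrite /reduced cardsE cardE {1}/enum_mem -enumT.
have mk j : (m j < k.+1)%N.
  by rewrite ltnS (leq_trans (leq_weight m (w_gt0 j))) // (leq_trans _ wtk) ?leq_addl.
pose e : {ffun 'I_n -> 'I_B.+1} := [ffun j => inord (if (B <= m j)%N then 0%N else m j)].
pose h : {ffun 'I_N -> 'I_n} := [ffun j : 'I_N => nth z bs j].
pose f : {ffun 'I_N -> 'I_k.+1} :=
  [ffun j : 'I_N => inord (if (j < size bs)%N then m (nth z bs j) else 0%N)].
have ik : (i < k.+1)%N by rewrite ltnS (leq_trans _ wtk) ?leq_addr.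
suff -> : y z ^+ i * mmap1 y m = g (inord i, e, h, f) by apply: spanned_gen.
rewrite /g /= inordK //; congr (_ * _).
have -> : \prod_(j < N) y (h j) ^+ f j = \prod_(j <- bs) y j ^+ m j.
  rewrite (big_nth z) big_mkord (big_ord_widen N (fun j => y (nth z bs j) ^+ m (nth z bs j))) //.
  rewrite [RHS]big_mkcond; apply: eq_bigr => j _; rewrite !ffunE inordK; last first.
    by case: ifP.
  by case: ifP => // _; rewrite expr0.
rewrite big_filter /mmap1 big_enum_cond /= (bigID (fun j => (B <= m j)%N)) /= mulrC.
congr (_ * _); rewrite [RHS](bigID (fun j => (B <= m j)%N)) /= [X in X * _]big1 ?mul1r.
  by apply: eq_bigr => j /negbTE Bm; rewrite ffunE Bm inordK // ltnW // ltnS ltnNge Bm.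
by move=> j Bm; rewrite ffunE Bm inordK ?expr0.
Qed.

(* Any [N + 1] of the variables satisfy a homogeneous relation modulo [z], as
   otherwise a prime containing [z] would give a specialization of larger
   transcendence degree. By the leading monomials of these relations, all but
   boundedly many exponents of a reduced monomial are confined to [N] variables. *)
Lemma growth_specialize (K L : fieldType) (iota : {rmorphism K -> L}) n
    (y : 'I_n -> L) (w : 'I_n -> nat) (z : 'I_n) (N : nat) :
  (forall i, (0 < w i)%N) ->
  (forall (L' : fieldType) (iota' : {rmorphism K -> L'}) (y' : 'I_n -> L'),
     y' z = 0 ->
     (forall p, weighted_eval w iota y p = 0 -> mmap iota' y' p = 0) ->
     growth iota' (fun u => exists i, u = y' i) N) ->
  growth iota (fun u => exists i, u = y i) N.+1.
Proof.
move=> w_gt0 spec.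
(* This is the ideal generated by ['X_z] and the kernel of the weighted evaluation. *)
pose J (p : {mpoly K[n]}) :=
  exists q, weighted_eval w iota y p = weighted_eval w iota y ('X_z * q).
have rwS (S : {set 'I_n}) : #|S| = N.+1 ->
    exists gh, rewrites iota y w z gh.1 gh.2 /\ involves S gh.1.
  move=> cS; suff [f [[q fE] f0 fS]] : exists f, [/\ J f, f != 0 & involves S f].
    have [g [h [gh gS]]] := rewrites_exists w_gt0 f0 fS fE.
    by exists (g, h).
  apply: contrapT => nf.
  have [||||||P [JP SP]] := @prime_avoiding _ J (fun f => f != 0 /\ involves S f).
  - by exists 0; rewrite mulr0.
  - move=> u v [q uE] [q' vE]; exists (q + q').
    by rewrite mulrDr [LHS]rmorphD [RHS]rmorphD uE vE.
  - by move=> c u [q uE]; exists (c * q); rewrite mulrCA [LHS]rmorphM [RHS]rmorphM uE.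
  - split; first exact: oner_neq0.
    by move=> m; rewrite msupp1 inE => /eqP-> i _; rewrite mnm0E.
  - move=> u v [u0 uS] [v0 vS]; split; first exact: mulf_neq0.
    move=> m /msuppM_le /allpairsP[[m1 m2] /= [/uS d1 /vS d2 ->]] i iS.
    by rewrite mnmDE d1 ?d2.
  - by move=> f Jf [f0 fS]; apply: nf; exists f.
  (* In the residue field of [P] the variable [z] becomes 0, while the [N.+1] variables in [S] stay
     independent, contrary to [growth_dependent]. *)
  pose phi := residue P.
  pose iota' : {rmorphism K -> residue_field P} := phi \o (@mpolyC n K).
  have evE p : mmap iota' (fun i => phi 'X_i) p = phi p.
    rewrite [in RHS](mpolyE p) rmorph_sum /mmap; apply: eq_bigr => m _.
    rewrite -mul_mpolyC rmorphM mpolyXE_id rmorph_prod /mmap1.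
    by congr (_ * _); apply: eq_bigr => i _; rewrite rmorphXn.
  have J0 u : J u -> phi u = 0 by move=> /JP; rewrite -residue_eq0 => /eqP.
  have gP : growth iota' (fun u => exists i, u = phi 'X_i) N.
    apply: spec; first by apply: J0; exists 1; rewrite mulr1.
    move=> p p0; rewrite evE; apply: J0; exists 0.
    by rewrite mulr0 p0 rmorph0.
  have [||p [p0 pS pE]] := @growth_dependent _ _ _ _ _ _ (fun i => phi 'X_i) S gP.
  - by rewrite cS.
  - by move=> i _; exists i.
  by have /negP[] := SP p (conj p0 pS); rewrite -residue_eq0 -/phi -evE pE.
pose gh (S : {set 'I_n}) : {mpoly K[n]} * {mpoly K[n]} :=
  if pselect (exists gh, rewrites iota y w z gh.1 gh.2 /\ involves S gh.1)
  is left e then projT1 (cid e) else 0.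
have ghP (S : {set 'I_n}) : #|S| = N.+1 ->
    rewrites iota y w z (gh S).1 (gh S).2 /\ involves S (gh S).1.
  move=> /rwS e; rewrite /gh; case: pselect => // e'; exact: projT2 (cid e').
(* Summing over the finitely many [S] gives one bound above the degrees of all the leading
   monomials. *)
pose B := (\sum_(S : {set 'I_n}) (mdeg (mlead (gh S).1)).+1)%N.
have red := @monomial_reducible K L iota n y w z N B _.
have {}red m : reducible_to iota y w z N B (weight w m) (mmap1 y m).
  apply: red => S cS; have [ghS gS] := ghP S cS.
  exists (gh S).1, (gh S).2; split=> //.
  by rewrite /B (bigD1 S) //= addSn ltnS leq_addr.
pose W := (\sum_i w i)%N.
exists (B.+1 ^ n * n ^ N * W.+1 ^ N.+1)%N => d.
have [I [g [cI sg]]] := @reducible_spanned K L iota n y w z N B (d * W) w_gt0.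
exists I, g; split.
  apply: leq_trans cI _; rewrite -!mulnA !leq_mul2l.
  by rewrite -expnMn leq_exp2r //; apply/orP; right; apply/orP; right; nia.
move=> u /pol_range [p [<- pd]]; apply: spanned_sum => m mp.
apply: spannedZ; apply: sg.
have [s [sP ->]] := red m; exists s; split=> // t /sP [ts rt]; split=> //.
apply: leq_trans ts _; apply: leq_trans (weight_leq w m) _.
by rewrite leq_mul2r pd ?orbT.
Qed.

(** * Permanents as products of linear forms *)

Section SquarefreeProducts.
Variables (A : comNzRingType) (C : finType).
Implicit Types (u v : C -> A) (f g : {set C} -> A) (J : {set C}).

(* A function [f] on subsets stands for the element [\sum_J f J e_J] of the
   algebra generated by the [e_j] subject to [e_j^2 = 0]; [star u f] is its
   product with the linear form [\sum_j u_j e_j]. *)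
Definition star u f J : A := \sum_(j in J) u j * f (J :\ j).

Lemma eq_star u u' f f' J :
  (forall j, j \in J -> u j = u' j) ->
  (forall j, j \in J -> f (J :\ j) = f' (J :\ j)) ->
  star u f J = star u' f' J.
Proof. by move=> uu' ff'; apply: eq_bigr => j jJ; rewrite uu' ?ff'. Qed.

Lemma starD u f g J : star u (fun J' => f J' + g J') J = star u f J + star u g J.
Proof. by rewrite -big_split; apply: eq_bigr => j _; rewrite mulrDr. Qed.

Lemma starZ u a f J : star u (fun J' => a * f J') J = a * star u f J.
Proof. by rewrite mulr_sumr; apply: eq_bigr => j _; rewrite mulrCA. Qed.

Lemma star_sum (T : Type) (r : seq T) u (F : T -> {set C} -> A) J :
  star u (fun J' => \sum_(t <- r) F t J') J = \sum_(t <- r) star u (F t) J.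
Proof.
rewrite exchange_big /=; apply: eq_bigr => j _.
by rewrite mulr_sumr.
Qed.

Lemma starC u v f J : star u (star v f) J = star v (star u f) J.
Proof.
have starE u1 u2 : star u1 (star u2 f) J =
    \sum_(j in J) \sum_(k in J | k != j) u1 j * u2 k * f (J :\ j :\ k).
  apply: eq_bigr => j _; rewrite mulr_sumr; apply: eq_big => k.
    by rewrite !inE andbC.
  by rewrite mulrA.
rewrite !starE (exchange_big_dep (mem J)) /=; last by move=> j k _ /andP[].
apply: eq_bigr => k kJ; apply: eq_big => [j|j _].
  by rewrite kJ eq_sym.
by rewrite [u j * _]mulrC; congr (_ * f _); apply/setP => l; rewrite !inE andbCA.
Qed.

(** This is the Leibniz rule for the derivative with respect to [e_j0]. *)
Lemma star_setU1 u f j0 J : j0 \notin J ->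
  star u f (j0 |: J) = u j0 * f J + star u (fun J' => f (j0 |: J')) J.
Proof.
move=> j0J; rewrite {1}/star big_setU1 //= setU1K //; congr (_ + _).
apply: eq_bigr => j jJ; congr (_ * f _); apply/setP => l; rewrite !inE.
have [->|//] := eqVneq l j0.
by rewrite /= ?andbT; apply: contraNneq j0J => ->.
Qed.

(** The coefficient of [e_J] in the product of the rows in [Q] is the permanent of these rows and
    the columns [J] if their numbers agree, and 0 otherwise. *)
Definition sper (I : Type) (M : I -> C -> A) (Q : seq I) : {set C} -> A :=
  foldr (fun i => star (M i)) (fun J => (J == set0)%:R) Q.

Lemma eq_sper (I : eqType) (M N : I -> C -> A) (Q : seq I) J :
  (forall i j, i \in Q -> j \in J -> M i j = N i j) -> sper M Q J = sper N Q J.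
Proof.
elim: Q J => [//|i Q IH] J MN /=; apply: eq_star => j jJ.
  by rewrite MN ?mem_head.
by apply: IH => i' j' i'Q; rewrite inE => /andP[_ j'J]; apply: MN; rewrite // inE i'Q orbT.
Qed.

Lemma sper_card I (M : I -> C -> A) Q J : #|J| != size Q -> sper M Q J = 0.
Proof.
elim: Q J => [|i Q IH] J /=; first by rewrite cards_eq0 => /negbTE->.
move=> cJ; rewrite /star big1 // => j jJ; rewrite IH ?mulr0 //.
by move: cJ; rewrite (cardsD1 j J) jJ.
Qed.

Lemma sper_perm (I : eqType) (M : I -> C -> A) (Q Q' : seq I) :
  perm_eq Q Q' -> sper M Q =1 sper M Q'.
Proof.
have front i Q1 : i \in Q1 -> forall J, sper M Q1 J = sper M (i :: rem i Q1) J.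
  elim: Q1 => // q Q1 IH; rewrite inE /=; have [-> //|ne /= iQ] := eqVneq i q.
  move=> J; rewrite /= starC.
  by apply: eq_star => // j _; rewrite IH.
elim: Q Q' => [|i Q IH] Q' pQ J; first by rewrite perm_sym in pQ; rewrite (perm_nilP pQ).
have iQ' : i \in Q' by rewrite -(perm_mem pQ) mem_head.
rewrite (front i Q' iQ') /=; apply: eq_star => // j _; apply: IH.
by have := perm_trans pQ (perm_to_rem iQ'); rewrite perm_cons.
Qed.

Lemma sper_scale (I : eqType) (M : I -> C -> A) (lam : I -> A) (mu : C -> A) Q J :
  sper (fun i j => lam i * mu j * M i j) Q J =
    \prod_(i <- Q) lam i * \prod_(j in J) mu j * sper M Q J.
Proof.
elim: Q J => [|i Q IH] J /=.
  have [->|_] := eqVneq J set0; last by rewrite !mulr0.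
  by rewrite big_nil big_set0 !mulr1.
rewrite big_cons -starZ; apply: eq_bigr => j jJ; rewrite IH (big_setD1 j jJ) /=.
ring.
Qed.

Variables (I : eqType) (M : I -> C -> A) (j0 : C).
Implicit Types Q : seq I.

(* The derivative of the product of the rows [Q] with respect to [e_j0]. *)
Definition sderiv Q J : A := sper M Q (j0 |: J).

(** With [c_i = M i j0] this is the sum of the [c_i g_(Q - i)]; every pair of rows enters it
    twice. *)
Definition ssum Q J : A := \sum_(i <- Q) M i j0 * sderiv (rem i Q) J.

Lemma sderiv_cons i Q J : j0 \notin J ->
  sderiv (i :: Q) J = M i j0 * sper M Q J + star (M i) (sderiv Q) J.
Proof. exact: star_setU1. Qed.

Lemma rem_cons i Q : uniq (i :: Q) ->
  {in Q, forall q, rem q (i :: Q) = i :: rem q Q}.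
Proof. by move=> /andP[iQ _] q qQ /=; case: eqP => // iq; rewrite iq qQ in iQ. Qed.

(** The Leibniz rule, one row at a time, identifies [sderiv Q] with [g_Q]. *)
Lemma sderiv_sum Q J : uniq Q -> j0 \notin J ->
  sderiv Q J = \sum_(i <- Q) M i j0 * sper M (rem i Q) J.
Proof.
elim: Q J => [|i Q IH] J uQ j0J.
  rewrite big_nil /sderiv /= (_ : _ == set0 = false) //.
  by apply/negbTE/set0Pn; exists j0; rewrite setU11.
rewrite sderiv_cons // big_cons /= eqxx; congr (_ + _).
have /andP[_ uQ'] := uQ.
transitivity (star (M i) (fun J' => \sum_(q <- Q) M q j0 * sper M (rem q Q) J') J).
  by apply: eq_star => // j _; rewrite IH // !inE negb_and j0J orbT.
rewrite star_sum [LHS]big_seq [RHS]big_seq; apply: eq_bigr => q qQ.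
by have /= -> := rem_cons uQ qQ; rewrite starZ.
Qed.

(** The coefficient 2 arises because the new row can be either the first or the second of the two
    rows that use column [j0]. *)
Lemma ssum_cons i Q J : uniq (i :: Q) -> j0 \notin J ->
  ssum (i :: Q) J = 2%:R * M i j0 * sderiv Q J + star (M i) (ssum Q) J.
Proof.
move=> uQ j0J; have /andP[_ uQ'] := uQ.
rewrite /ssum big_cons /= eqxx star_sum.
have -> : \sum_(q <- Q) M q j0 * sderiv (if i == q then Q else i :: rem q Q) J =
    \sum_(q <- Q) (M i j0 * (M q j0 * sper M (rem q Q) J) +
                   star (M i) (fun J' => M q j0 * sderiv (rem q Q) J') J).
  rewrite [LHS]big_seq [RHS]big_seq; apply: eq_bigr => q qQ.
  have /= -> := rem_cons uQ qQ.
  by rewrite sderiv_cons // starZ; ring.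
by rewrite big_split -mulr_sumr -sderiv_sum // addrA; congr (_ + _); ring.
Qed.

End SquarefreeProducts.

Lemma rmorph_star (A B : comNzRingType) (phi : {rmorphism A -> B}) (C : finType)
    (u : C -> A) f (J : {set C}) :
  phi (star u f J) = star (phi \o u) (phi \o f) J.
Proof. by rewrite rmorph_sum; apply: eq_bigr => j _; rewrite rmorphM. Qed.

Lemma rmorph_sper (A B : comNzRingType) (phi : {rmorphism A -> B}) (C : finType)
    I (M : I -> C -> A) Q (J : {set C}) :
  phi (sper M Q J) = sper (fun i j => phi (M i j)) Q J.
Proof.
elim: Q J => [|i Q IH] J /=; first by rewrite rmorph_nat.
by rewrite rmorph_star; apply: eq_star => // j _ /=; rewrite IH.
Qed.

Lemma rmorph_ssum (A B : comNzRingType) (phi : {rmorphism A -> B}) (C : finType)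
    (I : eqType) (M : I -> C -> A) j0 Q (J : {set C}) :
  phi (ssum M j0 Q J) = ssum (fun i j => phi (M i j)) j0 Q J.
Proof.
rewrite rmorph_sum; apply: eq_bigr => i _.
by rewrite rmorphM [phi (sderiv _ _ _ _)]rmorph_sper.
Qed.

(** * Relations between a pivot, its row and column, and the remaining entries *)

Definition vanishing (A : comNzRingType) (I C : finType) (M : I -> C -> A)
    (R : {set I}) (D : {set C}) (h : nat) : Prop :=
  forall (Q : seq I) (J : {set C}), uniq Q -> size Q = h ->
    {subset Q <= R} -> J \subset D -> sper M Q J = 0.

Section Relations.
Variables (A : comNzRingType) (I C : finType) (M : I -> C -> A).
Variables (R : {set I}) (D : {set C}) (i0 : I) (j0 : C) (h : nat).
Hypotheses (i0R : i0 \in R) (j0D : j0 \in D) (vanM : vanishing M R D h.+1).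

Lemma van_corner Q (J : {set C}) : uniq Q -> size Q = h -> {subset Q <= R :\ i0} ->
  J \subset D :\ j0 ->
  M i0 j0 * sper M Q J + star (M i0) (sderiv M j0 Q) J = 0.
Proof.
move=> uQ sQ QR JD; have j0J : j0 \notin J.
  by apply: contraTN JD => j0J; apply/subsetPn; exists j0; rewrite // !inE eqxx.
rewrite -sderiv_cons //; apply: vanM; rewrite //= ?sQ //.
- by rewrite uQ andbT; apply/negP => /QR; rewrite !inE eqxx.
- by move=> i; rewrite inE => /orP[/eqP->//|/QR]; rewrite inE => /andP[].
- by rewrite subUset sub1set j0D (subset_trans JD) // subD1set.
Qed.

Lemma van_row Q (J : {set C}) : uniq Q -> size Q = h -> {subset Q <= R :\ i0} ->
  J \subset D :\ j0 -> star (M i0) (sper M Q) J = 0.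
Proof.
move=> uQ sQ QR JD; apply: (vanM (Q := i0 :: Q)); rewrite //= ?sQ //.
- by rewrite uQ andbT; apply/negP => /QR; rewrite !inE eqxx.
- by move=> i; rewrite inE => /orP[/eqP->//|/QR]; rewrite inE => /andP[].
- by rewrite (subset_trans JD) // subD1set.
Qed.

(** Multiply [van_corner] by the row [i0]; the term with the pivot disappears by [van_row]. *)
Lemma van_row2 Q (J : {set C}) : uniq Q -> size Q = h -> {subset Q <= R :\ i0} ->
  J \subset D :\ j0 -> star (M i0) (star (M i0) (sderiv M j0 Q)) J = 0.
Proof.
move=> uQ sQ QR JD.
rewrite (@eq_star _ _ _ (M i0) _ (fun J' => - M i0 j0 * sper M Q J')) //.
  by rewrite starZ van_row ?mulr0.
move=> j jJ; apply/eqP; rewrite mulNr -addr_eq0 addrC; apply/eqP/van_corner => //.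
by rewrite (subset_trans _ JD) // subD1set.
Qed.

(** By [van_corner] the row times [g_(Q - i)] is minus the pivot times [f_(Q - i)]. Summing with the
    coefficients [c_i] gives minus the pivot times [g_Q], which vanishes because [Q] has [h.+1]
    rows. *)
Lemma van_sum Q (J : {set C}) : uniq Q -> size Q = h.+1 -> {subset Q <= R :\ i0} ->
  J \subset D :\ j0 -> star (M i0) (ssum M j0 Q) J = 0.
Proof.
move=> uQ sQ QR JD; have j0J : j0 \notin J.
  by apply: contraTN JD => j0J; apply/subsetPn; exists j0; rewrite // !inE eqxx.
rewrite star_sum.
rewrite big_seq (eq_bigr (fun i => - M i0 j0 * (M i j0 * sper M (rem i Q) J))).
  rewrite -big_seq -mulr_sumr -sderiv_sum // [sderiv _ _ _ _]vanM ?mulr0 //.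
    by move=> i /QR; rewrite inE => /andP[].
  by rewrite subUset sub1set j0D (subset_trans JD) // subD1set.
move=> i iQ; rewrite starZ mulrCA; congr (_ * _).
apply/eqP; rewrite mulNr -addr_eq0 addrC; apply/eqP/van_corner => //.
- exact: rem_uniq.
- by rewrite size_rem // sQ.
- by move=> q /mem_rem; apply: QR.
Qed.

End Relations.

Section InfieldPermanents.
Variables (K L : fieldType) (iota : {rmorphism K -> L}) (E : L -> Prop).
Variables (C : finType) (I : eqType) (M : I -> C -> L).

Lemma infield_star u f (J : {set C}) :
  (forall j, j \in J -> infield iota E (u j)) ->
  (forall j, j \in J -> infield iota E (f (J :\ j))) ->
  infield iota E (star u f J).
Proof. by move=> iu iff; apply: infield_sum => j jJ; apply: infieldM; auto. Qed.

Lemma infield_sper Q (J : {set C}) :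
  (forall i j, i \in Q -> j \in J -> infield iota E (M i j)) ->
  infield iota E (sper M Q J).
Proof.
elim: Q J => [|i Q IH] J iM /=; first exact: infield_nat.
apply: infield_star => j jJ; first by apply: iM; rewrite ?mem_head.
apply: IH => i' j' i'Q; rewrite inE => /andP[_ j'J].
by apply: iM; rewrite // inE i'Q orbT.
Qed.

Lemma infield_sderiv j0 Q (J : {set C}) :
  (forall i, i \in Q -> infield iota E (M i j0)) ->
  (forall i j, i \in Q -> j \in J -> infield iota E (M i j)) ->
  infield iota E (sderiv M j0 Q J).
Proof.
move=> ic im; apply: infield_sper => i j iQ.
by rewrite !inE => /orP[/eqP->|jJ]; auto.
Qed.

Lemma infield_ssum j0 Q (J : {set C}) :
  (forall i, i \in Q -> infield iota E (M i j0)) ->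
  (forall i j, i \in Q -> j \in J -> infield iota E (M i j)) ->
  infield iota E (ssum M j0 Q J).
Proof.
move=> ic im; rewrite /ssum big_seq; apply: infield_sum => i iQ.
apply: infieldM; first exact: ic.
by apply: infield_sderiv => [q /mem_rem|q j /mem_rem]; auto.
Qed.

Lemma infield_solve a b x : a != 0 -> a * x + b = 0 ->
  infield iota E a -> infield iota E b -> infield iota E x.
Proof.
move=> a0 eq ia ib; have -> : x = a^-1 * - b.
  by apply: (mulfI a0); rewrite mulVKf //; apply/eqP; rewrite -addr_eq0 eq.
by apply: infieldM; [exact: infieldV|exact: infieldN].
Qed.

End InfieldPermanents.

(** * The limit of the pivot tending to infinity *)

Section LimitCases.
Variables (K L : fieldType) (iota : {rmorphism K -> L}).
Variables (I C : finType) (M : I -> C -> L) (R : {set I}) (D : {set C}).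
Variables (i0 : I) (j0 : C) (h : nat).
Hypotheses (two_neq0 : 2%:R != 0 :> L).
Hypotheses (i0R : i0 \in R) (j0D : j0 \in D).
Hypotheses (leRD : (#|R| <= #|D|)%N) (ltD : (h.+2 < #|D|)%N).

Let R' := R :\ i0.
Let D' := D :\ j0.
Let r := M i0.

Definition minor_entries (u : L) : Prop :=
  exists i j, [/\ i \in R', j \in D' & u = M i j].

Definition offcorner_entries (u : L) : Prop :=
  exists i j, [/\ i \in R, j \in D, (i, j) != (i0, j0) & u = M i j].

Hypothesis row2 : forall (Q : seq I) (J : {set C}), uniq Q -> size Q = h.+1 -> {subset Q <= R'} ->
  J \subset D' -> star r (star r (sderiv M j0 Q)) J = 0.
Hypothesis rsum : forall (Q : seq I) (J : {set C}), uniq Q -> size Q = h.+2 -> {subset Q <= R'} ->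
  J \subset D' -> star r (ssum M j0 Q) J = 0.
Hypothesis growth1 : growth iota minor_entries (#|D'| * h).
Hypothesis growth2 : (0 < h)%N -> vanishing M R' D' h ->
  growth iota minor_entries (#|D'| * h.-1).

Let cD : #|D| = #|D'|.+1.
Proof. by rewrite (cardsD1 j0) j0D. Qed.

Let cR : (#|R'| <= #|D'|)%N.
Proof. by rewrite -ltnS -cD (leq_trans _ leRD) // (cardsD1 i0 R) i0R. Qed.

Let gens (ts : seq L) (u : L) := minor_entries u \/ u \in ts.

(** The target is [#|D| * h.+1 - 1]. To reach it, it suffices to list generators [ts] that determine
    row [i0] and column [j0] over the minor. *)
Let growth_gens N0 (ts : seq L) :
  growth iota minor_entries N0 -> (N0 + size ts <= #|D'| * h + h + #|D'|)%N ->
  (forall j, j \in D' -> infield iota (gens ts) (M i0 j)) ->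
  (forall i, i \in R' -> infield iota (gens ts) (M i j0)) ->
  growth iota offcorner_entries (#|D'| * h + h + #|D'|).
Proof.
move=> gm leN ir ic; apply: (growth_leq leN).
pose s := [seq M p.1 p.2 | p <- enum [set p : I * C | [&& p.1 \in R, p.2 \in D & p != (i0, j0)]]].
apply: (@growth_sub _ _ _ (fun u => u \in s)).
  move=> _ [i [j [iR jD nij ->]]]; apply/mapP; exists (i, j) => //.
  by rewrite mem_enum inE /= iR jD.
apply: growth_infield (growth_adjoins ts gm) _ => _ /mapP[[i j] + ->] /=.
rewrite mem_enum inE /= => /and3P[iR jD nij].
have [iE|ni] := eqVneq i i0; have [jE|nj] := eqVneq j j0.
- by rewrite iE jE eqxx in nij.
- by rewrite iE; apply: ir; rewrite !inE nj.
- by rewrite jE; apply: ic; rewrite !inE ni.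
- by apply: infield_gen; left; exists i, j; rewrite !inE ni nj.
Qed.

Let in_minor ts i j : i \in R' -> j \in D' -> infield iota (gens ts) (M i j).
Proof. by move=> iR jD; apply: infield_gen; left; exists i, j. Qed.

Let in_gen ts u : u \in ts -> infield iota (gens ts) u.
Proof. by move=> uts; apply: infield_gen; right. Qed.

Let sub_setD1 (J : {set C}) j : J \subset D' -> J :\ j \subset D'.
Proof. by apply: subset_trans; rewrite subD1set. Qed.

Let j0_notin (J : {set C}) : J \subset D' -> j0 \notin J.
Proof.
move=> JD; apply: contraTN JD => j0J; apply/subsetPn.
by exists j0; rewrite // !inE eqxx.
Qed.

(** All of [r] and the [c_i] with [i] in [Q] are taken as generators. For any other row [i], the
    relation [row2] for [i :: Q] is affine in [c_i], with the nonzero coefficient of the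
    hypothesis. *)
Lemma limit_square Q (J : {set C}) : uniq Q -> size Q = h -> {subset Q <= R'} ->
  J \subset D' -> star r (star r (sper M Q)) J != 0 ->
  growth iota offcorner_entries (#|D'| * h + h + #|D'|).
Proof.
move=> uQ sQ QR JD a0.
pose ts := [seq r j | j <- enum D'] ++ [seq M i j0 | i <- Q].
have ir j : j \in D' -> infield iota (gens ts) (r j).
  by move=> jD; apply: in_gen; rewrite mem_cat map_f // mem_enum.
have icQ i : i \in Q -> infield iota (gens ts) (M i j0).
  by move=> iQ; apply: in_gen; rewrite mem_cat map_f ?orbT.
apply: (growth_gens (ts := ts) growth1) => //.
  by rewrite size_cat !size_map -cardE sQ; lia.
move=> i iR; have [|iQ] := boolP (i \in Q); first exact: icQ.
have irJ j : j \in J -> infield iota (gens ts) (r j) by move=> /(subsetP JD)/ir.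
have := row2 (Q := i :: Q) (J := J); rewrite /= iQ uQ sQ => /(_ isT erefl) eq.
apply: (@infield_solve _ _ _ _ _ (star r (star r (star (M i) (sderiv M j0 Q))) J) _ a0).
- rewrite mulrC -eq //; last by move=> q; rewrite inE => /orP[/eqP->|/QR].
  rewrite -!starZ -starD; apply: eq_star => // j jJ; rewrite -starZ -starD.
  apply: eq_star => // k kJ; rewrite sderiv_cons ?j0_notin //.
  by do 2 apply: sub_setD1.
- apply: infield_star => // j jJ; apply: infield_star => [k|k kJ].
    by rewrite inE => /andP[_ /irJ].
  apply: infield_sper => q l qQ; rewrite !inE => /and3P[_ _ lJ].
  by apply: in_minor; [exact: QR|exact: (subsetP JD)].
- apply: infield_star => // j jJ; apply: infield_star => [k|k kJ].
    by rewrite inE => /andP[_ /irJ].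
  apply: infield_star => [l|l lJ].
    by rewrite !inE => /and3P[_ _ lJ]; apply: in_minor => //; exact: (subsetP JD).
  apply: infield_sderiv => // q l' qQ; rewrite !inE => /and4P[_ _ _ l'J].
  by apply: in_minor; [exact: QR|exact: (subsetP JD)].
Qed.

(* The equation [sq0] is quadratic in [r]; its coefficient at [r_k] gives [r_k]
   in terms of the rest of [r]. The equations [rsum] are affine in each [c_i],
   so that at most one [c_i] with [i] outside [Q] remains free. *)
Lemma limit_product Q (J : {set C}) : uniq Q -> size Q = h -> {subset Q <= R'} ->
  J \subset D' -> star r (sper M Q) J != 0 ->
  (forall J' : {set C}, J' \subset D' -> star r (star r (sper M Q)) J' = 0) ->
  growth iota offcorner_entries (#|D'| * h + h + #|D'|).
Proof.
move=> uQ sQ QR JD a0 sq0; set a := star r (sper M Q) J in a0.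
have cJ : #|J| = h.+1.
  apply/eqP; apply: contraNT a0 => cJ; rewrite /a /star big1 // => j jJ.
  rewrite sper_card ?mulr0 // sQ; move: cJ; rewrite (cardsD1 j) jJ eqSS.
  by [].
(* A further column exists since [#|J| = h.+1 < #|D'|]. *)
have [k kD kJ] : exists2 k, k \in D' & k \notin J.
  apply/subsetPn/negP => /subset_leq_card; rewrite cJ.
  by move: ltD; rewrite cD; lia.
pose ts i1 := [seq r j | j <- enum (D' :\ k)] ++ [seq M i j0 | i <- i1 :: Q].
have szts i1 : (size (ts i1) = #|D'| + h)%N.
  by rewrite size_cat !size_map -cardE /= sQ addnS (cardsD1 k D') kD.
have ir' i1 j : j \in D' :\ k -> infield iota (gens (ts i1)) (r j).
  by move=> jD; apply: in_gen; rewrite mem_cat map_f // mem_enum.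
have JD' : J \subset D' :\ k by rewrite subsetD1 JD.
have irJ i1 j : j \in J -> infield iota (gens (ts i1)) (r j).
  by move=> /(subsetP JD')/ir'.
have ia i1 : infield iota (gens (ts i1)) a.
  apply: infield_star => [j|j jJ]; first exact: irJ.
  apply: infield_sper => q l qQ; rewrite !inE => /andP[_ lJ].
  by apply: in_minor; [exact: QR|exact: (subsetP JD)].
have ir i1 j : j \in D' -> infield iota (gens (ts i1)) (r j).
  move=> jD; have [->|jk] := eqVneq j k; last by apply: ir'; rewrite in_setD1 jk.
  have kJD : k |: J \subset D' by rewrite subUset sub1set kD.
  pose b := star r (star r (fun J' => sper M Q (k |: J'))) J.
  apply: (@infield_solve _ _ _ _ (2%:R * a) b).
  - by rewrite mulf_neq0.
  - rewrite -(sq0 _ kJD) star_setU1 // mulrDl mul1r -/a.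
    rewrite (_ : star r (fun J' => star r (sper M Q) (k |: J')) J = r k * a + b).
      by ring.
    rewrite /a -starZ -starD; apply: eq_star => // l lJ.
    by rewrite star_setU1 // !inE negb_and kJ orbT.
  - by apply: infieldM => //; apply: infield_nat.
  - apply: infield_star => [l /irJ //|l lJ]; apply: infield_star => [l'|l' l'J].
      by rewrite inE => /andP[_ /irJ].
    apply: infield_sper => q l'' qQ l''J; apply: in_minor; first exact: QR.
    move: l''J; rewrite !inE => /orP[/eqP->|/and3P[_ _ /(subsetP JD)]].
      by move: kD; rewrite !inE.
    by rewrite !inE.
pose beta i := star r (star (M i) (sderiv M j0 Q)) J.
have icQ i1 i : i \in i1 :: Q -> infield iota (gens (ts i1)) (M i j0).
  by move=> iQ; apply: in_gen; rewrite mem_cat map_f ?orbT.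
have imJ i1 i j : i \in R' -> j \in J -> infield iota (gens (ts i1)) (M i j).
  by move=> iR /(subsetP JD); apply: in_minor.
have ibeta i1 i : i \in R' -> infield iota (gens (ts i1)) (beta i).
  move=> iR; apply: infield_star => [j /irJ //|j jJ]; apply: infield_star => [l|l lJ].
    by rewrite inE => /andP[_ lJ]; apply: imJ.
  apply: infield_sderiv => [q qQ|q l' /QR qR].
    by apply: icQ; rewrite inE qQ orbT.
  by rewrite !inE => /and3P[_ _ l'J]; apply: imJ.
(* In [rsum] for [[:: i, i1 & Q]], the coefficient of [c_i] is twice this expression. If it is
   nonzero for some [i1], then [c_i1] is the one free entry; if it is zero for every [i1], its
   vanishing already determines each [c_i1]. *)
have [[i1 [i1R i1Q b0]]|nob] := pselect (exists i1,
    [/\ i1 \in R', i1 \notin Q & M i1 j0 * a + beta i1 != 0]).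
- apply: (growth_gens (ts := ts i1) growth1); first by rewrite szts; lia.
    by move=> j; apply: ir.
  move=> i iR; have [|iQ] := boolP (i \in i1 :: Q); first exact: icQ.
  pose g := star r (star (M i) (star (M i1) (ssum M j0 Q))) J.
  apply: (@infield_solve _ _ _ _ (2%:R * (M i1 j0 * a + beta i1))
            (2%:R * (M i1 j0 * beta i) + g)).
  + by rewrite mulf_neq0.
  + have uQ1 : uniq [:: i, i1 & Q] by rewrite /= iQ i1Q.
    have := rsum (Q := [:: i, i1 & Q]) (J := J) uQ1; rewrite /= sQ => /(_ erefl) <- //.
      rewrite (_ : star r (ssum M j0 [:: i, i1 & Q]) J =
        star r (fun J' => 2%:R * M i j0 * (M i1 j0 * sper M Q J' + star (M i1) (sderiv M j0 Q) J') +
          (2%:R * M i1 j0 * star (M i) (sderiv M j0 Q) J' +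
            star (M i) (star (M i1) (ssum M j0 Q)) J')) J).
        by rewrite !(starD, starZ) -/a -/(beta i) -/(beta i1) -/g; ring.
      apply: eq_star => // j jJ; have j0J := j0_notin (sub_setD1 j JD).
      rewrite ssum_cons // sderiv_cons //; congr (_ + _).
      rewrite -starZ -starD; apply: eq_star => // l lJ.
      rewrite ssum_cons //; first by case/andP: uQ1.
      by apply/j0_notin/sub_setD1/sub_setD1.
    by move=> q; rewrite in_cons in_cons => /or3P[/eqP->|/eqP->|/QR].
  + apply: infieldM; first exact: infield_nat.
    apply: infieldD; last exact: ibeta.
    by apply: infieldM => //; apply: icQ; rewrite mem_head.
  + apply: infieldD.
      apply: infieldM; first exact: infield_nat.
      apply: infieldM; last exact: ibeta.
      by apply: icQ; rewrite mem_head.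
    apply: infield_star => [j /irJ //|j jJ]; apply: infield_star => [l|l lJ].
      by rewrite inE => /andP[_ lJ]; apply: imJ.
    apply: infield_star => [l'|l' l'J].
      by rewrite !inE => /and3P[_ _ l'J]; apply: imJ.
    apply: infield_ssum => [q qQ|q l'' /QR qR].
      by apply: icQ; rewrite inE qQ orbT.
    by rewrite !inE => /and4P[_ _ _ l''J]; apply: imJ.
(* Here [i0] merely fills the place of the free row. *)
- apply: (growth_gens (ts := ts i0) growth1); first by rewrite szts; lia.
    by move=> j; apply: ir.
  move=> i iR; have [iQ|iQ] := boolP (i \in Q).
    by apply: icQ; rewrite inE iQ orbT.
  apply: (@infield_solve _ _ _ _ a (beta i)) => //; last exact: ibeta.
  apply/eqP; apply: contrapT => /negP b0; apply: nob; exists i.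
  by rewrite [M i j0 * a]mulrC.
Qed.

(** The coefficient of [r f_Q = 0] at [j |: J] expresses [r j] by the entries of [r] in [J]. These
    [h] entries and the whole column are the generators; the column has at most [#|D'|] entries. *)
Lemma limit_row Q (J : {set C}) : uniq Q -> size Q = h -> {subset Q <= R'} ->
  J \subset D' -> sper M Q J != 0 ->
  (forall J' : {set C}, J' \subset D' -> star r (sper M Q) J' = 0) ->
  growth iota offcorner_entries (#|D'| * h + h + #|D'|).
Proof.
move=> uQ sQ QR JD a0 row0.
have cJ : #|J| = h.
  by apply/eqP; apply: contraNT a0 => cJ; rewrite sper_card ?sQ.
pose ts := [seq r j | j <- enum J] ++ [seq M i j0 | i <- enum R'].
have irJ j : j \in J -> infield iota (gens ts) (r j).
  by move=> jJ; apply: in_gen; rewrite mem_cat map_f // mem_enum.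
apply: (growth_gens (ts := ts) growth1).
- by rewrite size_cat !size_map -!cardE cJ -addnA !leq_add2l.
- move=> j jD; have [/irJ //|jJ] := boolP (j \in J).
  apply: (@infield_solve _ _ _ _ (sper M Q J) (star r (fun J' => sper M Q (j |: J')) J)) => //.
  + by rewrite mulrC -star_setU1 // row0 // subUset sub1set jD.
  + apply: infield_sper => q l /QR qR /(subsetP JD); exact: in_minor.
  + apply: infield_star => // l lJ; apply: infield_sper => q l' /QR qR l'J.
    apply: in_minor => //; move: l'J; rewrite !inE => /orP[/eqP->|/andP[_ /(subsetP JD)]].
      by move: jD; rewrite !inE.
    by rewrite !inE.
- by move=> i iR; apply: in_gen; rewrite mem_cat map_f ?orbT // mem_enum.
Qed.

(** The cases are whether some [r^2 f_Q], [r f_Q] or [f_Q] with [size Q = h] is nonzero, in this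
    order. If none is, the minor satisfies the stronger bound [growth2], and the [#|D'|] saved there
    pays for taking all of [r] and [c] as generators. *)
Lemma limit_growth : growth iota offcorner_entries (#|D'| * h + h + #|D'|).
Proof.
have [[Q [J [[uQ sQ QR] JD a0]]]|no1] := pselect (exists Q (J : {set C}),
    [/\ [/\ uniq Q, size Q = h & {subset Q <= R'}], J \subset D' &
     star r (star r (sper M Q)) J != 0]); first exact: (limit_square uQ sQ QR JD a0).
have [[Q [J [[uQ sQ QR] JD a0]]]|no2] := pselect (exists Q (J : {set C}),
    [/\ [/\ uniq Q, size Q = h & {subset Q <= R'}], J \subset D' &
     star r (sper M Q) J != 0]).
  apply: (limit_product uQ sQ QR JD a0) => J' J'D; apply/eqP.
  by apply: contrapT => /negP n0; apply: no1; exists Q, J'.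
have [[Q [J [[uQ sQ QR] JD a0]]]|no3] := pselect (exists Q (J : {set C}),
    [/\ [/\ uniq Q, size Q = h & {subset Q <= R'}], J \subset D' & sper M Q J != 0]).
  apply: (limit_row uQ sQ QR JD a0) => J' J'D; apply/eqP.
  by apply: contrapT => /negP n0; apply: no2; exists Q, J'.
have van : vanishing M R' D' h.
  move=> Q J uQ sQ QR JD; apply/eqP; apply: contrapT => /negP n0; apply: no3.
  by exists Q, J.
(* The empty product is 1, so for [h = 0] it cannot vanish. *)
have h_gt0 : (0 < h)%N.
  rewrite lt0n; apply/eqP => h0.
  have := van [::] set0; rewrite h0 /= eqxx => /(_ isT erefl) v1.
  by move/eqP: (v1 (fun x nx => False_ind _ (notF nx)) (sub0set _)); rewrite oner_eq0.
pose ts := [seq r j | j <- enum D'] ++ [seq M i j0 | i <- enum R'].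
apply: (growth_gens (ts := ts) (growth2 h_gt0 van)).
- rewrite size_cat !size_map -!cardE.
  by case: (h) h_gt0 => // h' _; rewrite /= mulnS; lia.
- by move=> j jD; apply: in_gen; rewrite mem_cat map_f // mem_enum.
- by move=> i iR; apply: in_gen; rewrite mem_cat map_f ?orbT // mem_enum.
Qed.

End LimitCases.

Local Notation "x %:F" := (FracField.tofrac x).

(** * Weighted homogeneous relations after inverting the pivot *)

Section Degeneration.
Variables (K L : fieldType) (iota : {rmorphism K -> L}).
Variables (I C : finType) (M : I -> C -> L) (R : {set I}) (D : {set C}).
Variables (i0 : I) (j0 : C) (h : nat).
Hypotheses (i0R : i0 \in R) (j0D : j0 \in D) (x0 : M i0 j0 != 0).
Hypothesis vanM : vanishing M R D h.+2.

Let n := #|{: I * C}|.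

Definition entry_var i j : 'I_n := enum_rank (i, j).

(* The corner variable stands for the inverse of the pivot [M i0 j0]. *)
Definition degen_point (k : 'I_n) : L :=
  let p := enum_val k in
  if p == (i0, j0) then (M i0 j0)^-1
  else if (p.1 \in R) && (p.2 \in D) then M p.1 p.2 else 0.

(* Scaling row [i0] by [t^(-2)], column [j0] by [t] and the other columns by
   [t^3] scales the pivot by [t^(-1)] and the other entries by positive powers
   of [t]; the weights are the exponents for [degen_point]. *)
Definition degen_weight (k : 'I_n) : nat :=
  let p := enum_val k in if (p.1 == i0) || (p.2 == j0) then 1%N else 3%N.

Let X i j : {mpoly K[n]} := 'X_(entry_var i j).
Let Phi := weighted_eval degen_weight iota degen_point.
Let e : {rmorphism {mpoly K[n]} -> {fraction {poly L}}} :=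
  (@FracField.tofrac {poly L}) \o Phi.
Let N i j := if (i, j) == (i0, j0) then (e (X i0 j0))^-1 else e (X i j).

Let eX i j : e (X i j) =
  (degen_point (entry_var i j) *: 'X^(degen_weight (entry_var i j)))%:F.
Proof. by rewrite /= mmapX mmap1U. Qed.

(** On [R] and [D], [N] is [M] with rows and columns scaled by powers of [t], which multiplies each
    subpermanent by a power of [t]. *)
Let N_vanishing : vanishing N R D h.+2.
Proof.
pose t : {fraction {poly L}} := 'X%:F.
have t0 : t != 0 by rewrite tofrac_eq0 polyX_eq0.
pose c : {rmorphism L -> {fraction {poly L}}} := (@FracField.tofrac {poly L}) \o polyC.
pose lam i := if i == i0 then t ^- 2 else 1.
pose mu j := if j == j0 then t else t ^+ 3.
have NE i j : i \in R -> j \in D -> N i j = lam i * mu j * c (M i j).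
  move=> iR jD; rewrite /N !eX /degen_point /degen_weight /entry_var !enum_rankK /=.
  rewrite xpair_eqE iR jD !eqxx /lam /mu -!mul_polyC !tofracM !tofracXn -/t.
  have [->|_] := eqVneq i i0; have [->|_] := eqVneq j j0 => /=.
  - rewrite expr1 invfM -[in LHS](fmorphV c) invrK mulrC; congr (_ * _).
    by rewrite exprS expr1 invfM -mulrA mulVf // mulr1.
  - by rewrite expr1 [t ^+ 3]exprSr mulKf ?expf_neq0 // mulrC.
  - by rewrite expr1 mulrC mul1r.
  - by rewrite mulrC mul1r.
move=> Q J uQ sQ QR JD.
rewrite (@eq_sper _ _ _ N (fun i j => lam i * mu j * c (M i j))).
  by rewrite sper_scale -rmorph_sper vanM // rmorph0 mulr0.
by move=> i j /QR iR /(subsetP JD); apply: NE.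
Qed.

Let corner_neq0 : e (X i0 j0) != 0.
Proof.
rewrite eX tofrac_eq0 scaler_eq0 negb_or expf_neq0 ?polyX_eq0 // andbT.
by rewrite /degen_point /entry_var enum_rankK eqxx invr_eq0.
Qed.

Let off_row i j : i != i0 -> N i j = e (X i j).
Proof. by move=> ni; rewrite /N xpair_eqE (negbTE ni). Qed.

Let off_col i j : j != j0 -> N i j = e (X i j).
Proof. by move=> nj; rewrite /N xpair_eqE (negbTE nj) andbF. Qed.

Variables (Q : seq I) (J : {set C}).
Hypotheses (uQ : uniq Q) (QR : {subset Q <= R :\ i0}) (JD : J \subset D :\ j0).

Let Q_off i : i \in Q -> i != i0.
Proof. by move=> /QR; rewrite !inE => /andP[]. Qed.

Let J_off j : j \in J -> j != j0.
Proof. by move=> /(subsetP JD); rewrite !inE => /andP[]. Qed.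

Let e_eq0 p : e p = 0 -> Phi p = 0.
Proof. by move=> /eqP; rewrite /= tofrac_eq0 => /eqP. Qed.

Let e_sper Q' (J' : {set C}) : {subset Q' <= Q} -> e (sper X Q' J') = sper N Q' J'.
Proof.
move=> Q'Q; rewrite rmorph_sper; apply: eq_sper => i j /Q'Q iQ _.
by rewrite off_row ?Q_off.
Qed.

Let e_star f f' (J' : {set C}) : J' \subset J ->
  (forall j, j \in J' -> e (f (J' :\ j)) = f' (J' :\ j)) ->
  e (star (X i0) f J') = star (N i0) f' J'.
Proof.
move=> J'J ff'; rewrite rmorph_star; apply: eq_star => j jJ /=; last exact: ff'.
by rewrite off_col ?J_off // (subsetP J'J).
Qed.

Let D1J (J' : {set C}) j : J' \subset J -> J' :\ j \subset J.
Proof. by apply: subset_trans; rewrite subD1set. Qed.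

(** This is [van_corner] divided by the pivot, so that only the inverse of the pivot occurs and may
    be set to 0. *)
Lemma degen_corner : size Q = h.+1 ->
  Phi (sper X Q J + X i0 j0 * star (X i0) (sderiv X j0 Q) J) = 0.
Proof.
move=> sQ; apply: e_eq0.
have := van_corner i0R j0D N_vanishing uQ sQ QR JD.
rewrite {1}/N eqxx => eqN; rewrite rmorphD rmorphM e_sper //.
rewrite (@e_star _ (sderiv N j0 Q)) // => [|j _]; last exact: e_sper.
apply: (mulfI (invr_neq0 corner_neq0)).
by rewrite mulr0 mulrDr mulKf // eqN.
Qed.

(** The relation [van_row2] does not contain the pivot and transfers unchanged, as does [van_sum]
    below. *)
Lemma degen_row2 : size Q = h.+1 ->
  Phi (star (X i0) (star (X i0) (sderiv X j0 Q)) J) = 0.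
Proof.
move=> sQ; apply: e_eq0; rewrite -(van_row2 i0R j0D N_vanishing uQ sQ QR JD).
apply: e_star => // j _; apply: e_star => [|k _]; first exact: D1J.
exact: e_sper.
Qed.

Lemma degen_sum : size Q = h.+2 -> Phi (star (X i0) (ssum X j0 Q) J) = 0.
Proof.
move=> sQ; apply: e_eq0; rewrite -(van_sum i0R j0D N_vanishing uQ sQ QR JD).
apply: e_star => // j _; rewrite rmorph_sum [RHS]big_seq [LHS]big_seq.
apply: eq_bigr => i iQ; rewrite rmorphM off_row ?Q_off //; congr (_ * _).
by apply: e_sper => q /mem_rem.
Qed.

End Degeneration.

(** * The growth bound for matrices with vanishing subpermanents *)

Definition entries (L : fieldType) (I C : finType) (M : I -> C -> L)
    (R : {set I}) (D : {set C}) (u : L) : Prop :=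
  exists i j, [/\ i \in R, j \in D & u = M i j].

Lemma growth_finite (K L : fieldType) (iota : {rmorphism K -> L})
    (I C : finType) (M : I -> C -> L) (R : {set I}) (D : {set C}) (E : L -> Prop) N :
  growth iota E N ->
  (forall i j, i \in R -> j \in D -> infield iota E (M i j)) ->
  growth iota (entries M R D) N.
Proof.
move=> gE iM.
apply: (@growth_sub _ _ _ (fun u => u \in [seq M p.1 p.2 | p <- enum (setX R D)])).
  move=> _ [i [j [iR jD ->]]]; apply/mapP; exists (i, j) => //.
  by rewrite mem_enum inE /= iR.
apply: growth_infield gE _ => _ /mapP[[i j] + ->].
by rewrite mem_enum inE => /andP[]; apply: iM.
Qed.

Theorem vanishing_growth (K : fieldType) (h : nat) : 2%:R != 0 :> K ->
  forall (L : fieldType) (iota : {rmorphism K -> L}) (I C : finType)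
    (M : I -> C -> L) (R : {set I}) (D : {set C}),
  (#|R| <= #|D|)%N -> (h.+1 < #|D|)%N -> vanishing M R D h.+1 ->
  growth iota (entries M R D) (#|D| * h).
Proof.
(* The induction is strong because [limit_growth] uses the bounds for the two preceding values of
   [h]. *)
move=> two0; have [k] := ubnP h; elim: k h => // k IHk h; rewrite ltnS => lehk.
move=> L iota I C M R D leRD ltD van.
have zero_case : (forall i j, i \in R -> j \in D -> M i j = 0) ->
    growth iota (entries M R D) (#|D| * h).
  move=> M0; apply: growth_finite (growth_leq (leq0n _) (growth_none iota)) _.
  by move=> i j iR jD; rewrite M0 //; apply: infield0.
case: h lehk ltD van zero_case => [|h] lehk ltD van zero_case.
  apply: zero_case => i j iR jD; have := van [:: i] [set j] isT erefl.
  rewrite /= /star big_set1 setDv eqxx mulr1; apply.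
    by move=> i'; rewrite inE => /eqP->.
  by rewrite sub1set.
have [[i0 [j0 [i0R j0D x0]]]|allz] := pselect (exists i0 j0,
    [/\ i0 \in R, j0 \in D & M i0 j0 != 0]); last first.
  apply: zero_case => i j iR jD; apply/eqP; apply: contrapT => /negP n0.
  by apply: allz; exists i, j.
pose R' := R :\ i0; pose D' := D :\ j0.
have cD : #|D| = #|D'|.+1 by rewrite (cardsD1 j0) j0D.
have cR : (#|R'| <= #|D'|)%N.
  by rewrite -ltnS -cD (leq_trans _ leRD) // (cardsD1 i0 R) i0R.
(* The successor is the loss in [growth_specialize]; the rest is the bound of [limit_growth]. *)
have -> : (#|D| * h.+1 = (#|D'| * h + h + #|D'|).+1)%N by rewrite cD; lia.
pose y := degen_point M R D i0 j0.
suff gy : growth iota (fun u => exists i, u = y i) (#|D'| * h + h + #|D'|).+1.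
  apply: growth_finite gy _ => i j iR jD.
  pose c := entry_var i j.
  have yc : infield iota (fun u => exists i, u = y i) (y c).
    by apply: infield_gen; exists c.
  have yE : y c = if (i, j) == (i0, j0) then (M i0 j0)^-1 else M i j.
    by rewrite /y /degen_point /c /entry_var enum_rankK /= iR jD.
  move: yc; rewrite yE xpair_eqE; case: ifP => // /andP[/eqP-> /eqP->] iV.
  by rewrite -[M _ _]invrK; apply: infieldV.
apply: (growth_specialize (w := degen_weight i0 j0) (z := entry_var i0 j0)).
  by move=> c; rewrite /degen_weight; case: ifP.
move=> L' iota' y' y'0 rel.
pose ev : {rmorphism {mpoly K[#|{: I * C}|]} -> L'} := mmap iota' y'.
pose N i j := ev 'X_(entry_var i j).
have NE i j : N i j = y' (entry_var i j) by rewrite /N /= mmapX mmap1U.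
have two0' : 2%:R != 0 :> L' by rewrite -(rmorph_nat iota') fmorph_eq0.
have van' (Q : seq I) (J : {set C}) : uniq Q -> size Q = h.+1 -> {subset Q <= R'} -> J \subset D' ->
    sper N Q J = 0.
  move=> uQ sQ QR JD; rewrite /N -rmorph_sper.
  have := rel _ (degen_corner iota i0R j0D x0 van uQ QR JD sQ).
  by rewrite -/(ev _) rmorphD rmorphM -/(N i0 j0) NE y'0 mul0r addr0.
have row2 (Q : seq I) (J : {set C}) : uniq Q -> size Q = h.+1 -> {subset Q <= R'} -> J \subset D' ->
    star (N i0) (star (N i0) (sderiv N j0 Q)) J = 0.
  move=> uQ sQ QR JD.
  rewrite -(rel _ (degen_row2 iota i0R j0D van uQ QR JD sQ)) -/(ev _).
  rewrite rmorph_star; apply: eq_star => // j _ /=; rewrite -/(ev _) rmorph_star.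
  by apply: eq_star => // l _ /=; rewrite -/(ev _) [RHS]rmorph_sper.
have rsum (Q : seq I) (J : {set C}) : uniq Q -> size Q = h.+2 -> {subset Q <= R'} -> J \subset D' ->
    star (N i0) (ssum N j0 Q) J = 0.
  move=> uQ sQ QR JD.
  rewrite -(rel _ (degen_sum iota i0R j0D van uQ QR JD sQ)) -/(ev _).
  rewrite rmorph_star; apply: eq_star => // j _ /=; rewrite -/(ev _).
  by rewrite [RHS]rmorph_ssum.
have ltD' : (h.+1 < #|D'|)%N by rewrite -ltnS -cD.
have g1 : growth iota' (entries N R' D') (#|D'| * h) by apply: IHk.
have g2 : (0 < h)%N -> vanishing N R' D' h -> growth iota' (entries N R' D') (#|D'| * h.-1).
  by move=> h0 vanh; apply: IHk; rewrite ?prednK //; lia.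
have gN := limit_growth two0' i0R j0D leRD ltD row2 rsum g1 g2.
apply: (@growth_sub _ _ _ (fun u => u \in [seq y' i | i <- enum 'I_#|{: I * C}|])).
  by move=> _ [i ->]; apply: map_f; rewrite mem_enum.
apply: growth_infield gN _ => _ /mapP[c _ ->].
have -> : c = entry_var (enum_val c).1 (enum_val c).2.
  by rewrite /entry_var -surjective_pairing enum_valK.
case: (enum_val c) => i j /=.
have [ij0|nij] := eqVneq (i, j) (i0, j0).
  by case: ij0 => -> ->; rewrite y'0; apply: infield0.
have [/andP[iR jD]|out] := boolP ((i \in R) && (j \in D)).
  by apply: infield_gen; exists i, j; rewrite -NE.
(* Outside [R] and [D] the coordinates of [y] are 0, and this homogeneous relation survives the
   specialization. *)
suff -> : y' (entry_var i j) = 0 by apply: infield0.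
rewrite -NE; apply: rel.
rewrite /= mmapX mmap1U /y /degen_point /entry_var enum_rankK /= (negbTE nij).
by rewrite (negbTE out) scale0r.
Qed.

(** * Coefficients of row products as subpermanents *)

Lemma sum_lift_perm (A : nmodType) n (F : 'S_n.+1 -> A) :
  \sum_(s : 'S_n.+1) F s =
    \sum_(j < n.+1) \sum_(s : 'S_n) F (lift_perm ord0 j s).
Proof.
rewrite (partition_big (fun s : 'S_n.+1 => s ord0) predT) //=.
apply: eq_bigr => j _; rewrite (reindex (lift_perm ord0 j)) /=.
  by apply: eq_bigl => s; rewrite lift_perm_id eqxx.
pose ulsf (s : 'S_n.+1) k := odflt k (unlift (s ord0) (s (lift ord0 k))).
have ulsfK (s : 'S_n.+1) k : lift (s ord0) (ulsf s k) = s (lift ord0 k).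
  rewrite /ulsf; have := neq_lift ord0 k.
  by rewrite -(can_eq (permK s)) => /unlift_some[] ? ? ->.
have inj_ulsf s : injective (ulsf s).
  move=> k1 k2 eqk; apply: (@lift_inj _ ord0); apply: (@perm_inj _ s).
  by rewrite -!ulsfK eqk.
exists (fun s => perm (inj_ulsf s)) => [s _ | s].
  apply/permP=> k'; rewrite permE; apply: (@lift_inj _ j).
  by have := ulsfK (lift_perm ord0 j s) k'; rewrite lift_perm_id lift_perm_lift.
rewrite inE => /eqP sj; apply/permP => i.
case: (unliftP ord0 i) => [k ->|->]; last by rewrite lift_perm_id.
by rewrite lift_perm_lift permE -sj ulsfK.
Qed.

(** Both sides expand along the first row; on the right, permutations are sorted by their value at
    [ord0]. *)
Lemma sper_sum_perm (A : comNzRingType) (I C : finType) (M : I -> C -> A) h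
    (f : 'I_h -> I) (g : 'I_h -> C) : injective g ->
  sper M [seq f i | i <- enum 'I_h] (g @: setT) =
    \sum_(s : 'S_h) \prod_(i < h) M (f i) (g (s i)).
Proof.
elim: h f g => [|h IH] f g g_inj.
  rewrite (_ : g @: setT = set0).
    rewrite (_ : enum 'I_0 = [::]) /= ?eqxx; last by apply: size0nil; rewrite size_enum_ord.
    rewrite (eq_bigr (fun=> 1)) => [|s _]; last by rewrite big_ord0.
    by rewrite sumr_const card_Sn.
  by apply/setP => c; rewrite inE; apply/imsetP => -[[]].
rewrite enum_ordSl /= sum_lift_perm {1}/star big_imset /=; last by move=> x y _ _ /g_inj.
apply: eq_big => [j|j _]; first by rewrite inE.
have -> : (g @: setT) :\ g j = (g \o lift j) @: setT.
  apply/setP => c; rewrite !inE; apply/andP/imsetP => [[nc /imsetP[k _ cE]]|[k _ ->]].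
    move: nc; rewrite cE (inj_eq g_inj) eq_sym => /unlift_some[k' -> _].
    by exists k'; rewrite ?inE.
  by rewrite /= (inj_eq g_inj) eq_sym neq_lift; split=> //; apply: imset_f; rewrite inE.
rewrite -map_comp (IH (f \o lift ord0)); last by move=> x y /= /g_inj/lift_inj.
rewrite mulr_sumr; apply: eq_bigr => s _; rewrite big_ord_recl lift_perm_id.
by congr (_ * _); apply: eq_bigr => i _; rewrite lift_perm_lift.
Qed.

Lemma permanent_tr (R : comNzRingType) n (A : 'M[R]_n) :
  permanent A^T = permanent A.
Proof.
rewrite /permanent (reindex_inj invg_inj); apply: eq_bigr => s _ /=.
rewrite (reindex_inj (@perm_inj _ s)); apply: eq_bigr => i _ /=.
by rewrite mxE permK.
Qed.

Lemma set_enumeration n h (S : {set 'I_n}) : (0 < h)%N -> #|S| = h ->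
  exists f : 'I_h -> 'I_n,
    [/\ forall i j : 'I_h, (i < j)%N -> (f i < f j)%N,
        [seq f i | i <- enum 'I_h] = enum S & f @: setT = S].
Proof.
move=> h0 cS; have [x0 x0S] : exists x0, x0 \in S by apply/card_gt0P; rewrite cS.
have szS : size (enum S) = h by rewrite -cardE.
have fE : [seq nth x0 (enum S) (i : 'I_h) | i <- enum 'I_h] = enum S.
  rewrite -[RHS](mkseq_nth x0) szS /mkseq -val_enum_ord -map_comp.
  exact: eq_map.
exists (fun i => nth x0 (enum S) i); split=> //.
- move=> i j ij; pose lt (x y : 'I_n) := (x < y)%N.
  have lt_tr : transitive lt by move=> x y z; apply: ltn_trans.
  have srt : sorted lt (enum S).
    rewrite [enum S]/enum_mem -enumT; apply: sorted_filter => //.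
    have := iota_ltn_sorted 0 n; rewrite -val_enum_ord sorted_map.
    exact.
  by apply: (sorted_ltn_nth lt_tr x0 srt); rewrite ?inE ?szS ?ltn_ord.
- apply/setP => c; rewrite -[in RHS](mem_enum S) -[in RHS]fE.
  apply/imsetP/mapP => -[i _ ->]; exists i; rewrite ?mem_enum ?in_setT //.
Qed.

Lemma sper_subpermanent (R : comNzRingType) a b h (A : 'M[R]_(a, b))
    (Q : seq 'I_a) (J : {set 'I_b}) :
  (0 < h)%N -> uniq Q -> size Q = h -> #|J| = h ->
  subpermanent h A (sper (fun i j => A i j) Q J).
Proof.
move=> h0 uQ sQ cJ; pose S := [set i in Q].
have cS : #|S| = h by rewrite cardsE (card_uniqP uQ).
have [f [f_inc fE _]] := set_enumeration h0 cS.
have [g [g_inc _ gE]] := set_enumeration h0 cJ.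
have g_inj : injective g.
  move=> i j gij; apply: val_inj; case: (ltngtP i j) => // /g_inc; rewrite gij ltnn //.
exists f, g; split=> //.
have pQ : perm_eq Q (enum S).
  by apply: uniq_perm; rewrite ?enum_uniq // => i; rewrite mem_enum inE.
rewrite (sper_perm _ pQ) -fE -gE sper_sum_perm // /permanent.
by apply: eq_bigr => s _; apply: eq_bigr => i _; rewrite mxE.
Qed.

Lemma subpermanent_tr (R : comNzRingType) a b h (A : 'M[R]_(a, b)) p :
  subpermanent h A^T p -> subpermanent h A p.
Proof.
move=> [f [g [f_inc g_inc ->]]]; exists g, f; split=> //.
by rewrite -permanent_tr; congr permanent; apply/matrixP => i j; rewrite !mxE.
Qed.

(** * Chains of primes in polynomial rings *)

Section PrimeKernels.
Variables (R : comNzRingType) (T : idomainType) (phi : {rmorphism R -> T}).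

Lemma ker_prime_exists :
  {P : prime_idealr R | forall p, (p \in P) = (phi p == 0)}.
Proof.
apply: cid; have [||P PE] := @prime_idealr_of R (fun p => phi p == 0).
- split; first by rewrite unfold_in rmorph0.
    by rewrite unfold_in rmorph1 oner_eq0.
  move=> c u v; rewrite !unfold_in rmorphD rmorphM => /eqP-> /eqP->.
  by rewrite mulr0 addr0.
- by move=> u v; rewrite rmorphM mulf_eq0.
by exists P => p; rewrite PE.
Qed.

Definition ker_prime : prime_idealr R := sval ker_prime_exists.

Lemma mem_ker_prime p : (p \in ker_prime) = (phi p == 0).
Proof. exact: (svalP ker_prime_exists). Qed.
End PrimeKernels.

Section Chains.
Variable R : comNzRingType.
Implicit Types (c : nat -> prime_idealr R) (P : prime_idealr R).

(** Indexing by [nat] lets chains be concatenated without casts; values beyond [n] are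
    unconstrained. *)
Definition chain (n : nat) c : Prop :=
  forall i, (i < n)%N -> strict_subset (c i) (c i.+1).

Lemma chain_lt n c i j : chain n c -> (i < j <= n)%N -> strict_subset (c i) (c j).
Proof.
move=> ch /andP[]; elim: j => // j IH; rewrite ltnS leq_eqVlt => /orP[/eqP->|ij] jn.
  exact: ch.
have [s1 n1] := IH ij (ltnW jn); have [s2 n2] := ch j jn.
by split=> [x /s1/s2//|s3]; apply: n2 => x /s3/s1.
Qed.

Lemma chain_of_prime_chain n (C : 'I_n.+1 -> prime_idealr R) :
  prime_chain C -> chain n (fun i => C (inord i)).
Proof. by move=> ch i lin; apply: ch; rewrite !inordK // ltnS ltnW. Qed.

Lemma prime_chain_of_chain n c : chain n c -> prime_chain (fun i : 'I_n.+1 => c i).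
Proof. by move=> ch i j ij; apply: (chain_lt ch); rewrite ij -ltnS ltn_ord. Qed.

Lemma chain_cat m n c d : chain m c -> chain n d ->
  (c m : {pred R}) =i (d 0%N : {pred R}) ->
  chain (m + n) (fun i => if (i < m)%N then c i else d (i - m)%N).
Proof.
move=> chc chd cd i lti; have [ltim|leim] := ltnP i m.
  have [s ns] := chc i ltim; have [//|leim] := ltnP i.+1 m.
  have im : i.+1 = m by apply/eqP; rewrite eqn_leq leim ltim.
  rewrite im subnn; split=> [x /s|sub]; first by rewrite im cd.
  by apply: ns => x; rewrite im cd; apply: sub.
rewrite ltnNge leqW //= subSn //; apply: chd.
by rewrite ltn_subLR.
Qed.

Lemma chain_ending_atP P n :
  chain_ending_at P n <-> exists c, chain n c /\ (c n : {pred R}) =i (P : {pred R}).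
Proof.
split=> [[C [ch CP]]|[c [ch cP]]].
  exists (fun i => C (inord i)); split; first exact: chain_of_prime_chain.
  have -> : inord n = ord_max :> 'I_n.+1 by apply: val_inj; rewrite /= inordK.
  exact: CP.
by exists (fun i => c i); split; [exact: prime_chain_of_chain|].
Qed.

Lemma chain_of_sets (I : finType) (k : {set I} -> prime_idealr R) (S U : {set I}) :
  S \subset U ->
  (forall (T : {set I}) j, S \subset T -> j \notin T ->
     strict_subset (k T) (k (j |: T))) ->
  exists c, [/\ chain #|U :\: S| c, c 0%N = k S & c #|U :\: S| = k U].
Proof.
move: {2}#|_| (erefl #|U :\: S|) => m; elim: m S => [|m IH] S cm SU kS.
  rewrite cm; exists (fun=> k S); split=> //; congr k; apply/eqP.
  by rewrite eqEsubset SU -setD_eq0 -cards_eq0 cm.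
have /card_gt0P [j] : (0 < #|U :\: S|)%N by rewrite cm.
rewrite inE => /andP[jS jU].
have cm' : #|U :\: (j |: S)| = m.
  by move: cm; rewrite (cardsD1 j) !inE jS jU setUC -setDDl => -[].
have [||c [ch c0 cU]] := IH (j |: S) cm'; first by rewrite subUset sub1set jU.
  by move=> T i; rewrite subUset => /andP[_]; apply: kS.
exists (fun i => if i is i'.+1 then c i' else k S); rewrite cm; split=> //.
  by case=> [|i] lti /=; [rewrite c0; apply: kS|apply: ch; rewrite cm'].
by rewrite -cU cm'.
Qed.

End Chains.

(** * Division of a polynomial by one variable *)

Section Elimination.
Variables (R : nzRingType) (n : nat) (i : 'I_n).
Implicit Types p : {mpoly R[n]}.

Definition free_part p : {mpoly R[n]} :=
  \sum_(m <- msupp p | m i == 0%N) p@_m *: 'X_[m].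

Definition div_part p : {mpoly R[n]} :=
  \sum_(m <- msupp p | m i != 0%N) p@_m *: 'X_[m - U_(i)].

Lemma free_div_part p : p = free_part p + div_part p * 'X_i.
Proof.
rewrite [LHS]mpolyE (bigID (fun m : 'X_{1..n} => m i == 0%N)) /=; congr (_ + _).
rewrite mulr_suml; apply: eq_bigr => m mi.
by rewrite -scalerAl -mpolyXD submK // lep1mP.
Qed.

Lemma free_part_supp p m : m \in msupp (free_part p) -> m \in msupp p /\ m i = 0%N.
Proof.
rewrite !mcoeff_msupp raddf_sum /= => nz; apply: contrapT => nm; case/eqP: nz.
rewrite big_seq_cond big1 // => m' /andP[m'p /eqP m'i].
rewrite mcoeffZ mcoeffX; case: eqP => [mm'|]; last by rewrite mulr0.
by case: nm; rewrite -mm' -mcoeff_msupp.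
Qed.

Lemma div_part_supp p m : m \in msupp (div_part p) -> (m + U_(i))%MM \in msupp p.
Proof.
rewrite !mcoeff_msupp raddf_sum /= => nz; apply: contraNneq nz => pm.
rewrite big_seq_cond big1 // => m' /andP[m'p m'i].
rewrite mcoeffZ mcoeffX; case: eqP => [mm'|]; last by rewrite mulr0.
have : (m + U_(i))%MM = m' by rewrite -mm' submK // lep1mP.
by move=> mE; rewrite -mE pm mul0r.
Qed.

End Elimination.

Section PolynomialDimension.
Variables (K : fieldType) (n : nat).
Notation R := {mpoly K[n]}.

(** The [n.+1] polynomials lie in the field generated by [n] variables, whose growth exponent is at
    most [n]. *)
Lemma polynomials_dependent (y : 'I_n.+1 -> R) :
  exists q : {mpoly K[n.+1]}, q != 0 /\ mmap (@mpolyC n K) y q = 0.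
Proof.
pose iota : {rmorphism K -> {fraction R}} := (@FracField.tofrac R) \o (@mpolyC n K).
pose X := [seq FracField.tofrac ('X_i : R) | i <- enum 'I_n].
have gX := growth_adjoins X (growth_none iota).
rewrite add0n size_map size_enum_ord in gX.
pose Y := [seq FracField.tofrac (y i) | i <- enum 'I_n.+1].
have gY : growth iota (fun x => x \in Y) n.
  apply: growth_infield gX _ => _ /mapP[i _ ->]; rewrite (mpolyE (y i)) rmorph_sum.
  apply: infield_sum => m _; rewrite -mul_mpolyC rmorphM; apply: infieldM.
    exists 0%N, 1; rewrite oner_eq0 mul1r; split=> //; first exact: pol1.
    exact: (pol_const iota _ (y i)@_m).
  rewrite mpolyXE_id rmorph_prod; elim/big_ind: _ => [||j _].
  - exact: (infield_nat _ _ 1).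
  - exact: infieldM.
  - rewrite rmorphXn; elim: (m j) => [|k IH]; first exact: (infield_nat _ _ 1).
    rewrite exprS; apply: infieldM => //; apply: infield_gen; right.
    by apply: map_f; rewrite mem_enum.
have [|i _|q [q0 _ qE]] := @growth_dependent _ _ iota _ _ _
    (fun i => FracField.tofrac (y i)) setT gY.
- by rewrite cardsT card_ord.
- by apply: map_f; rewrite mem_enum.
exists q; split=> //; apply/eqP; rewrite -tofrac_eq0 -qE rmorph_sum; apply/eqP.
apply: eq_bigr => m _; rewrite rmorphM rmorph_prod; congr (_ * _).
by apply: eq_bigr => i _; rewrite rmorphXn.
Qed.

(* If [y i] lies in [c (i + 1)] but not in [c i], an algebraic relation among
   the [y i] can be pushed up the chain, losing one variable at each step; at
   the top it would be a nonzero constant. *)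
Lemma chain_length (m : nat) (c : nat -> prime_idealr R) : chain m c -> (m <= n)%N.
Proof.
move=> ch; rewrite leqNgt; apply/negP => ltnm.
have /choice [y yP] : forall i : 'I_n.+1, exists y, y \in c i.+1 /\ y \notin c i.
  move=> i; apply: contrapT => ny; have [|_ ns] := ch i.
    by apply: leq_trans ltnm; rewrite ltnS leq_ord.
  apply: ns => x xc; apply: contrapT => /negP nx; apply: ny; exists x.
  by [].
pose ev : {rmorphism {mpoly K[n.+1]} -> R} := mmap (@mpolyC n K) y.
have step (i : 'I_n.+1) (q : {mpoly K[n.+1]}) : q != 0 ->
    (forall m, m \in msupp q -> forall j : 'I_n.+1, (j < i)%N -> m j = 0%N) ->
    ev q \in c i -> exists q', [/\ q' != 0,
    (forall m, m \in msupp q' -> forall j : 'I_n.+1, (j < i.+1)%N -> m j = 0%N) &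
    ev q' \in c i.+1].
  have [sub _] : strict_subset (c i) (c i.+1).
    by apply: ch; apply: leq_trans ltnm; rewrite ltnS leq_ord.
  have [yc ync] := yP i.
  (* If the part of [q] free of ['X_i] is nonzero, it serves as [q'], since [y i] lies in [c i.+1].
     Otherwise ['X_i] divides [q] and can be cancelled, since [c i] is prime and does not contain
     [y i]. *)
  have [k] := ubnP (msize q); elim: k q => // k IHk q; rewrite ltnS => szq q0 qS qc.
  have qE := free_div_part i q; have [f0|f0] := eqVneq (free_part i q) 0; last first.
    exists (free_part i q); split=> // [m' /free_part_supp[m'q m'i] j|].
      rewrite ltnS leq_eqVlt => /orP[/eqP/val_inj->//|]; exact: qS.
    have -> : ev (free_part i q) = ev q - ev (div_part i q) * y i.
      by rewrite [in ev q]qE rmorphD rmorphM [ev 'X_i]/= mmapX mmap1U addrK.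
    by apply: rpredB; [exact: sub|exact: idealMr].
  rewrite f0 add0r in qE.
  have d0 : div_part i q != 0 by apply: contraNneq q0 => d0; rewrite qE d0 mul0r.
  apply: (IHk (div_part i q)) => //.
  - apply: leq_trans szq; rewrite [in X in (_ < X)%N]qE msizeM ?mpolyX_eq0 //.
      rewrite msizeX mdeg1 addnC /=; exact: leqnn.
    by rewrite -msize_poly_eq0 msizeX.
  - move=> m' /div_part_supp m'q j ji; have := qS _ m'q j ji.
    by rewrite mnmDE => /eqP; rewrite addn_eq0 => /andP[/eqP].
  - move: qc; rewrite [in ev q]qE rmorphM [ev 'X_i]/= mmapX mmap1U.
    by rewrite prime_idealrM (negbTE ync) orbF.
have [q0 [q0n0 q0E]] := polynomials_dependent y.
have climb (i : nat) : (i <= n.+1)%N -> exists q : {mpoly K[n.+1]}, [/\ q != 0,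
    (forall m, m \in msupp q -> forall j : 'I_n.+1, (j < i)%N -> m j = 0%N) &
    ev q \in c i].
  elim: i => [_|i IH lti].
    by exists q0; split=> //; rewrite /ev /= q0E idealr0.
  have [q [qn0 qS qc]] := IH (ltnW lti).
  by have [q' q'P] := step (Ordinal lti) q qn0 qS qc; exists q'.
have [q [qn0 qS qc]] := climb _ (leqnn _).
have qC : q = (q@_0)%:MP.
  apply/mpolyP => m'; rewrite mcoeffC; have [->|m'0] := eqVneq m' 0%MM.
    by rewrite mulr1.
  rewrite mulr0; apply/eqP; apply: contraNT m'0; rewrite -mcoeff_msupp => m'q.
  by apply/eqP/mnmP => j; rewrite mnm0E; apply: (qS _ m'q).
have a0 : q@_0 != 0 by apply: contraNneq qn0 => a0; rewrite qC a0 mpolyC0.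
have evq : ev q = (q@_0)%:MP by rewrite {1}qC /ev /= mmapC.
have := idealMr ((q@_0)^-1)%:MP qc.
by rewrite evq -mpolyCM mulVf // mpolyC1 idealr1.
Qed.

End PolynomialDimension.

Lemma rmorph_mmap (A B D : comNzRingType) n (f : {rmorphism A -> B})
    (h : 'I_n -> B) (g : {rmorphism B -> D}) (p : {mpoly A[n]}) :
  g (mmap f h p) = mmap (g \o f) (fun i => g (h i)) p.
Proof.
rewrite rmorph_sum; apply: eq_bigr => m _; rewrite rmorphM rmorph_prod.
by congr (_ * _); apply: eq_bigr => i _; rewrite rmorphXn.
Qed.

Lemma involves_set0 n (R : nzRingType) (q : {mpoly R[n]}) :
  involves set0 q -> q = (q@_0)%:MP.
Proof.
move=> q0; apply/mpolyP => m; rewrite mcoeffC; have [->|m0] := eqVneq m 0%MM.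
  by rewrite mulr1.
rewrite mulr0; apply/eqP; apply: contraNT m0; rewrite -mcoeff_msupp => mq.
by apply/eqP/mnmP => j; rewrite mnm0E; apply: (q0 _ mq); rewrite inE.
Qed.

(** * Primes obtained by evaluating some of the variables *)

Section PartialEvaluation.
Variables (K L : fieldType) (iota : {rmorphism K -> L}) (n : nat) (y : 'I_n -> L).
Implicit Types (S T : {set 'I_n}).

Lemma independent_set0 (q : {mpoly K[n]}) :
  involves set0 q -> mmap iota y q = 0 -> q = 0.
Proof.
move=> /involves_set0 ->; rewrite mmapC => /eqP; rewrite fmorph_eq0 => /eqP->.
exact: mpolyC0.
Qed.

Definition partial_point T (i : 'I_n) : {mpoly L[n]} :=
  if i \in T then (y i)%:MP else 'X_i.

Definition partial_eval T : {rmorphism {mpoly K[n]} -> {mpoly L[n]}} :=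
  mmap (@mpolyC n L \o iota) (partial_point T).

Lemma partial_evalE T p :
  partial_eval T p = mmap (@mpolyC n L \o iota) (partial_point T) p.
Proof. by []. Qed.

Definition partial_ker T : prime_idealr {mpoly K[n]} := ker_prime (partial_eval T).

Lemma partial_kerP T p : p \in partial_ker T <-> partial_eval T p = 0.
Proof. by rewrite mem_ker_prime; split=> /eqP. Qed.

Lemma partial_ker_sub S T : S \subset T ->
  {subset (partial_ker S : {pred {mpoly K[n]}}) <= (partial_ker T : {pred {mpoly K[n]}})}.
Proof.
move=> ST p /partial_kerP p0; apply/partial_kerP.
pose g : {rmorphism {mpoly L[n]} -> {mpoly L[n]}} :=
  mmap (@mpolyC n L) (partial_point T).
have <- : g (partial_eval S p) = partial_eval T p.
  rewrite !partial_evalE rmorph_mmap; apply: eq_bigr => m _.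
  rewrite [(g \o _) _]mmapC; congr (_ * _); apply: mmap1_eq => i.
  rewrite {1}/partial_point; case: ifP => [iS|_].
    by rewrite [g _]mmapC /partial_point (subsetP ST).
  by rewrite [g _]mmapX mmap1U.
by rewrite p0 rmorph0.
Qed.

Lemma partial_evalT p : partial_eval setT p = (mmap iota y p)%:MP.
Proof.
rewrite partial_evalE (rmorph_mmap iota y (@mpolyC n L)).
by apply: eq_bigr => m _; congr (_ * _); apply: mmap1_eq => i; rewrite /partial_point inE.
Qed.

(** The relation [p] lies in the larger kernel. Were it in the smaller one, where ['X_j] stays free,
    each of its coefficients with respect to ['X_j] would vanish at [y], against the independence of
    [S]. *)
Lemma partial_ker_strict S T j (p : {mpoly K[n]}) :
  (forall q : {mpoly K[n]}, involves S q -> mmap iota y q = 0 -> q = 0) ->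
  S \subset T -> j \notin T ->
  p != 0 -> involves (j |: S) p -> mmap iota y p = 0 ->
  strict_subset (partial_ker T) (partial_ker (j |: T)).
Proof.
move=> indS ST jT p0 pS py0; split; first by apply: partial_ker_sub; apply: subsetUr.
have supp_in m i : m \in msupp p -> i \notin T -> i != j -> m i = 0%N.
  move=> mp iT ij; apply: (pS m mp); rewrite !inE negb_or ij.
  by apply: contra iT; apply: (subsetP ST).
move=> sub0; have sub : partial_eval T p = 0.
  apply/partial_kerP; apply: sub0; apply/partial_kerP.
  transitivity ((mmap iota y p)%:MP_[n]); last by rewrite py0 mpolyC0.
  rewrite -partial_evalT.
  rewrite !partial_evalE /mmap [LHS]big_seq [RHS]big_seq; apply: eq_bigr => m mp.
  congr (_ * _); apply: eq_bigr => i _; rewrite /partial_point !inE.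
  case: (boolP (i == j)) => [//|ij] /=.
  by case: ifP => // /negbT iT; rewrite (supp_in m) ?expr0.
(* The coefficient [q] of ['X_j ^+ e] is nonzero, as it contains the leading term of [p]. *)
pose e := mlead p j.
pose q : {mpoly K[n]} := \sum_(m <- msupp p | m j == e) p@_m *: 'X_[m - U_(j) *+ e].
have strip (m : 'X_{1..n}) : m j == e -> (m - U_(j) *+ e + U_(j) *+ e)%MM = m.
  move=> /eqP me; apply: submK; apply/mnm_lepP => i; rewrite mulmnE mnm1E.
  by case: eqP => [<-|_]; rewrite ?mul1n ?mul0n ?me.
have qS : involves S q.
  move=> m; rewrite mcoeff_msupp raddf_sum /= => nz i iS; apply: contraNeq nz => mi.
  rewrite big_seq_cond big1 // => m' /andP[m'p m'j]; rewrite mcoeffZ mcoeffX.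
  case: eqP => [mm|]; last by rewrite mulr0.
  case/eqP: mi; rewrite -mm mnmBE mulmnE mnm1E; have [<-|ji] := eqVneq j i.
    by rewrite mul1n (eqP m'j) subnn.
  by rewrite (pS m' m'p) // !inE negb_or eq_sym ji.
have qy0 : mmap iota y q = 0.
  have := congr1 (mcoeff (U_(j) *+ e)%MM) sub; rewrite mcoeff0 => <-.
  rewrite partial_evalE raddf_sum [RHS]raddf_sum /= [RHS]big_seq [LHS]big_seq_cond big_mkcondr /=.
  apply: eq_bigr => m mp; rewrite mmapZ mmapX mcoeffCM.
  have -> : mmap1 (partial_point T) m =
      (mmap1 y (m - U_(j) *+ m j)%MM)%:MP * 'X_[U_(j) *+ m j].
    rewrite /mmap1 /partial_point rmorph_prod (bigD1 j) //= [in RHS](bigD1 j) //= (negbTE jT).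
    rewrite mnmBE mulmnE mnm1E eqxx mul1n subnn expr0 mpolyC1 mul1r mulrC.
    rewrite mpolyXn; congr (_ * _); apply: eq_bigr => i ij.
    rewrite mnmBE mulmnE mnm1E eq_sym (negbTE ij) mul0n subn0 rmorphXn /=.
    by case: ifP => // /negbT iT; rewrite (supp_in m) // !expr0.
  rewrite mcoeffCM mcoeffX; case: ifP => [/eqP->|/negbT mj].
    by rewrite eqxx mulr1.
  case: eqP => [eq|]; last by rewrite !mulr0.
  have := congr1 (fun m' : 'X_{1..n} => m' j) eq; rewrite /= !mulmnE mnm1E eqxx !mul1n.
  by move/eqP; rewrite (negbTE mj).
have /eqP := indS q qS qy0; apply/negP.
have : q@_(mlead p - U_(j) *+ e) != 0; last by apply: contraNneq => ->; rewrite mcoeff0.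
have -> : q@_(mlead p - U_(j) *+ e) = p@_(mlead p); last by rewrite mleadc_eq0.
rewrite raddf_sum /= (big_rem _ (mlead_supp p0)) /= eqxx mcoeffZ mcoeffX eqxx mulr1.
rewrite big_seq_cond big1 ?addr0 // => m /andP[mp me]; rewrite mcoeffZ mcoeffX.
case: eqP => [mm|]; last by rewrite mulr0.
move: mp; rewrite mem_rem_uniq ?msupp_uniq // inE => /andP[/eqP[]].
by rewrite -(strip m me) mm strip.
Qed.

End PartialEvaluation.

(* Specialize the variables to their residues one at a time, starting from a
   transcendence basis: the kernels increase strictly up to [P]. *)
Lemma chain_below (K : fieldType) n (P : prime_idealr {mpoly K[n]}) N :
  growth (residue P \o @mpolyC n K) (fun u => exists i, u = residue P 'X_i) N ->
  exists m, (n - N <= m)%N /\ chain_ending_at P m.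
Proof.
set iota := (residue P \o @mpolyC n K : {rmorphism K -> residue_field P}).
pose y i := residue P 'X_i; move=> gP.
have evE p : mmap iota y p = residue P p.
  rewrite [in RHS](mpolyE p) rmorph_sum; apply: eq_bigr => m _.
  rewrite -mul_mpolyC rmorphM mpolyXE_id rmorph_prod.
  by congr (_ * _); apply: eq_bigr => i _; rewrite rmorphXn.
pose indep (S : {set 'I_n}) := `[< forall q : {mpoly K[n]},
  involves S q -> mmap iota y q = 0 -> q = 0 >].
have ind0 : indep set0 by apply/asboolP => q; apply: independent_set0.
(* A largest independent set of variables serves as a transcendence basis. *)
have [S indS maxS] := arg_maxnP (fun S : {set 'I_n} => #|S|) ind0.
have cS : (#|S| <= N)%N.
  rewrite leqNgt; apply/negP => ltN.
  have [|p [p0 pS py]] := growth_dependent (y := y) gP ltN; first by move=> i _; exists i.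
  by case/eqP: p0; apply: (asboolP _ indS).
have dep j : j \notin S -> exists p : {mpoly K[n]},
    [/\ p != 0, involves (j |: S) p & mmap iota y p = 0].
  move=> jS; apply: contrapT => np.
  have /maxS : indep (j |: S).
    apply/asboolP => q qS qy; apply/eqP; apply: contrapT => /negP q0.
    by apply: np; exists q.
  by rewrite /= cardsU1 jS ltnn.
have [|T j ST jT|c [ch c0 cT]] :=
    @chain_of_sets _ _ (partial_ker iota y) S setT; first exact: subsetT.
  have [p [p0 pS py]] : exists p : {mpoly K[n]},
      [/\ p != 0, involves (j |: S) p & mmap iota y p = 0].
    by apply: dep; apply: contra jT; apply: (subsetP ST).
  exact: (partial_ker_strict (asboolP _ indS) ST jT p0 pS py).
exists #|setT :\: S|; split.
  by rewrite setTD cardsCs setCK card_ord leq_sub2l.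
apply/chain_ending_atP; exists c; split=> // p.
rewrite cT mem_ker_prime partial_evalT mpolyC_eq0 evE; exact: residue_eq0.
Qed.

(** * Primes of a quotient ring and primes containing the ideal *)

Section QuotientPrimes.
Local Open Scope quotient_scope.
Variables (R : comNzRingType) (I : idealr R).
Notation proj := (\pi_({ideal_quot I}) : R -> {ideal_quot I}).

Lemma quotient_prime (P : prime_idealr R) :
  {subset (I : {pred R}) <= (P : {pred R})} ->
  exists Q : prime_idealr {ideal_quot I}, forall p, (proj p \in Q) = (p \in P).
Proof.
move=> IP; pose S (q : {ideal_quot I}) := repr q \in P.
have SE p : S (proj p) = (p \in P).
  have eqI : repr (proj p) - p \in P.
    by apply: IP; rewrite Quotient.idealrBE reprK.
  by rewrite /S -[p in RHS](subKr (repr (proj p))) rpredBr // .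
have [||Q QE] := @prime_idealr_of _ S.
- split.
  + by rewrite -[_ \in _]/(S 0) -(rmorph0 proj) SE idealr0.
  + by rewrite -[_ \in _]/(S 1) -(rmorph1 proj) SE idealr1.
  + move=> a u v; rewrite -[u \in _]/(S u) -[v \in _]/(S v) -[_ \in _]/(S (a * u + v)).
    rewrite -[a]reprK -[u]reprK -[v]reprK -(rmorphM proj) -(rmorphD proj) !SE => uP vP.
    by rewrite rpredD // idealMr.
- move=> u v; rewrite -[u]reprK -[v]reprK -rmorphM !SE.
  by rewrite prime_idealrM.
by exists Q => p; rewrite QE [_ \in _]SE.
Qed.

Lemma preim_prime (Q : prime_idealr {ideal_quot I}) :
  exists P : prime_idealr R, {subset (I : {pred R}) <= (P : {pred R})} /\
    forall p, (p \in P) = (proj p \in Q).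
Proof.
pose S p := proj p \in Q; have [||P PE] := @prime_idealr_of R S.
- split.
  + by rewrite -[_ \in _]/(S 0) /S rmorph0 idealr0.
  + by rewrite -[_ \in _]/(S 1) /S rmorph1 idealr1.
  + move=> a u v; rewrite -[u \in _]/(S u) -[v \in _]/(S v) -[_ \in _]/(S (a * u + v)).
    by rewrite /S rmorphD rmorphM => uQ vQ; rewrite rpredD // idealMr.
- by move=> u v; rewrite /S rmorphM prime_idealrM.
exists P; split=> [p pI|p]; rewrite PE -[_ \in _]/(S _) //.
have p0 : proj p = 0.
  by apply/eqP; rewrite -(rmorph0 proj) -Quotient.idealrBE subr0.
by rewrite /S p0 idealr0.
Qed.

Lemma quotient_chain n c : chain n c ->
  {subset (I : {pred R}) <= (c 0%N : {pred R})} ->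
  exists d : nat -> prime_idealr {ideal_quot I}, chain n d.
Proof.
move=> ch I0; have Ic i : (i <= n)%N -> {subset (I : {pred R}) <= (c i : {pred R})}.
  case: i => [//|i] lti p /I0; have [|s _] := @chain_lt _ n c 0 i.+1 ch; first by [].
  exact: s.
have /choice [d dE] : forall i, exists Q : prime_idealr {ideal_quot I},
    (i <= n)%N -> forall p, (proj p \in Q) = (p \in c i).
  move=> i; case: (leqP i n) => [/Ic/quotient_prime[Q QE]|_]; first by exists Q.
  (* Beyond [n] the prime [c i] need not contain [I], and any prime will do. *)
  by have [Q _] := quotient_prime I0; exists Q.
exists d => i lti; have [s ns] := ch i lti; split=> [q|sub].
  by rewrite -[q]reprK !dE // 1?ltnW //; apply: s.
by apply: ns => p; rewrite -!dE // 1?ltnW //; apply: sub.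
Qed.

Lemma preim_chain n (d : nat -> prime_idealr {ideal_quot I}) : chain n d ->
  exists c, chain n c /\ {subset (I : {pred R}) <= (c 0%N : {pred R})}.
Proof.
move=> ch; have /choice [c cE] := fun i => preim_prime (d i).
exists c; split; last exact: (cE 0%N).1.
move=> i /ch [s ns]; split=> [p|sub]; first by rewrite !(cE _).2; apply: s.
apply: ns => q; have := sub (repr q); rewrite !(cE _).2 reprK.
exact.
Qed.

End QuotientPrimes.

(** * Permanental ideals *)

Section Permanental.
Variables (K : fieldType) (a b h : nat) (h_gt0 : (0 < h)%N).
Notation R := {mpoly K[a * b]}.
Notation X := (generic_mx K a b).
Notation J := (permanental_ideal K a b h_gt0).

Lemma mem_permanental_ideal (p : R) : (p \in J) = (p \in @permanental_pred K a b h).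
Proof. by []. Qed.

Lemma subpermanent_in p : subpermanent h X p -> p \in J.
Proof.
move=> sp; rewrite mem_permanental_ideal; apply/asboolP; exists [:: (1, p)].
by split; [move=> cg; rewrite inE => /eqP->|rewrite big_seq1 mul1r].
Qed.

Lemma permanental_sub (P : prime_idealr R) :
  (forall p, subpermanent h X p -> p \in P) ->
  {subset (J : {pred R}) <= (P : {pred R})}.
Proof.
move=> XP p; rewrite mem_permanental_ideal => /asboolP[s [sX ->]].
rewrite big_seq; apply: rpred_sum => cg cgs.
by apply/idealMr/XP/sX.
Qed.

(** Since [vanishing_growth] asks for at least as many columns as rows, it is applied to the
    transpose if [b < a]. *)
Lemma permanental_growth (P : prime_idealr R) :
  2%:R != 0 :> K -> (h < maxn a b)%N ->
  {subset (J : {pred R}) <= (P : {pred R})} ->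
  growth (residue P \o @mpolyC (a * b) K) (fun u => exists i, u = residue P 'X_i)
    (maxn a b * h.-1).
Proof.
move=> two0 ltab JP.
have zero p : subpermanent h X p -> residue P p = 0.
  by move=> /subpermanent_in/JP; rewrite -residue_eq0 => /eqP.
have [leab|ltba] := leqP a b.
  apply: (@growth_sub _ _ _ (entries (fun i j => residue P (X i j)) setT setT)).
    move=> _ [k ->]; case/mxvec_indexP: k => i j; exists i, j.
    by rewrite !inE mxE.
  suff: growth (residue P \o @mpolyC (a * b) K) (entries (fun i j => residue P (X i j)) setT setT)
      (#|[set: 'I_b]| * h.-1) by rewrite cardsT card_ord.
  apply: (vanishing_growth two0); rewrite ?cardsT ?card_ord ?prednK //.
    by move: ltab; rewrite (maxn_idPr leab).
  move=> Q S uQ sQ _ _; rewrite -rmorph_sper.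
  have [cS|nS] := eqVneq #|S| h; first exact/zero/sper_subpermanent.
  by rewrite sper_card ?rmorph0 // sQ.
apply: (@growth_sub _ _ _ (entries (fun j i => residue P (X i j)) setT setT)).
  move=> _ [k ->]; case/mxvec_indexP: k => i j; exists j, i.
  by rewrite !inE mxE.
suff: growth (residue P \o @mpolyC (a * b) K) (entries (fun j i => residue P (X i j)) setT setT)
    (#|[set: 'I_a]| * h.-1) by rewrite cardsT card_ord.
apply: (vanishing_growth two0); rewrite ?cardsT ?card_ord ?prednK //.
- exact: ltnW.
- by move: ltab; rewrite (maxn_idPl (ltnW ltba)).
move=> Q S uQ sQ _ _; rewrite -rmorph_sper.
have [cS|nS] := eqVneq #|S| h; last by rewrite sper_card ?rmorph0 // sQ.
apply: zero; apply: subpermanent_tr.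
have := sper_subpermanent X^T h_gt0 uQ sQ cS; congr subpermanent.
by apply: eq_sper => i j _ _; rewrite mxE.
Qed.

Definition block (A : {set 'I_a}) (B : {set 'I_b}) : {set 'I_(a * b)} :=
  [set mxvec_index p.1 p.2 | p in setX A B].

Lemma mxvec_index_inj : injective (fun p : 'I_a * 'I_b => mxvec_index p.1 p.2).
Proof.
case: (curry_mxvec_bij a b) => g gK _; move=> [i j] [i' j'] /= eq.
by have := congr1 g eq; rewrite (gK (i, j)) // (gK (i', j')).
Qed.

Lemma mem_block A B i j : (mxvec_index i j \in block A B) = (i \in A) && (j \in B).
Proof.
by rewrite (mem_imset _ (i, j) mxvec_index_inj) inE.
Qed.

Lemma card_block A B : #|block A B| = (#|A| * #|B|)%N.
Proof. by rewrite card_imset ?cardsX //; apply: mxvec_index_inj. Qed.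

(** With all values 0, this kernel is the ideal generated by the variables in [T]. *)
Definition coord_prime (T : {set 'I_(a * b)}) : prime_idealr R :=
  partial_ker (GRing.RMorphism.clone K K idfun _) (fun=> 0) T.

Lemma coord_prime_strict (T : {set 'I_(a * b)}) k : k \notin T ->
  strict_subset (coord_prime T) (coord_prime (k |: T)).
Proof.
move=> kT; apply: (@partial_ker_strict _ _ _ _ _ set0 T k 'X_k) => //.
- exact: independent_set0.
- exact: sub0set.
- by rewrite -msize_poly_eq0 msizeX.
- move=> m; rewrite msuppX inE => /eqP-> i; rewrite !inE orbF mnm1E eq_sym.
  by move=> /negbTE->.
- by rewrite mmapX mmap1U.
Qed.

Lemma coord_prime_sub (A : {set 'I_a}) (B : {set 'I_b}) :
  (forall (f : 'I_h -> 'I_a) (g : 'I_h -> 'I_b) (s : 'S_h),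
    (forall i j : 'I_h, (i < j)%N -> (f i < f j)%N) ->
    (forall i j : 'I_h, (i < j)%N -> (g i < g j)%N) ->
    exists i, (f i \in A) && (g (s i) \in B)) ->
  {subset (J : {pred R}) <= (coord_prime (block A B) : {pred R})}.
Proof.
move=> hit; apply: permanental_sub => _ [f [g [f_inc g_inc ->]]].
apply/partial_kerP; rewrite rmorph_sum big1 // => s _.
have [i iAB] := hit f g s f_inc g_inc.
rewrite rmorph_prod (bigD1 i) //= !mxE mmapX mmap1U /partial_point mem_block iAB.
by rewrite mpolyC0 mul0r.
Qed.

Lemma coord_chain (S U : {set 'I_(a * b)}) : S \subset U ->
  exists c, [/\ chain #|U :\: S| c, c 0%N = coord_prime S & c #|U :\: S| = coord_prime U].
Proof.
by move=> SU; apply: chain_of_sets => // T j _; apply: coord_prime_strict.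
Qed.

Lemma card_ord_geq n k : #|[set i : 'I_n | (k <= i)%N]| = (n - k)%N.
Proof.
have := cardsC [set i : 'I_n | (k <= i)%N]; rewrite card_ord.
have -> : #|~: [set i : 'I_n | (k <= i)%N]| = minn k n.
  rewrite -sum1_card (eq_bigl (fun i : 'I_n => (i < k)%N)); last first.
    by move=> i; rewrite !inE ltnNge.
  have -> : (\sum_(i < n | (i < k)%N) 1 = \sum_(i < n | (i < minn k n)%N) 1)%N.
    by apply: eq_bigl => i; rewrite leq_min ltn_ord andbT.
  by rewrite -(big_ord_widen _ (fun=> 1%N)) ?geq_minr // sum1_card card_ord.
lia.
Qed.

Lemma leq_increasing n (f : 'I_h -> 'I_n) :
  (forall i j : 'I_h, (i < j)%N -> (f i < f j)%N) -> forall i : 'I_h, (i <= f i)%N.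
Proof.
move=> f_inc [i lti]; elim: i lti => // i IH lti.
by apply: leq_ltn_trans (IH (ltnW lti)) (f_inc (Ordinal (ltnW lti)) (Ordinal lti) _).
Qed.

(** All but the first [h - 1] rows, or columns if these are fewer, are set to 0. The last of [h]
    increasing indices is at least [h - 1], so every term of each permanent contains a zero
    entry. *)
Lemma coord_prime_exists : (h <= minn a b)%N ->
  exists T : {set 'I_(a * b)}, #|T| = (maxn a b * (minn a b - h.-1))%N /\
    {subset (J : {pred R}) <= (coord_prime T : {pred R})}.
Proof.
move=> hle; have lth : (h.-1 < h)%N by rewrite prednK.
have [leab|/ltnW leba] := leqP a b.
  exists (block [set i : 'I_a | (h.-1 <= i)%N] setT); split.
    by rewrite card_block cardsT card_ord card_ord_geq mulnC.
  apply: coord_prime_sub => f g s f_inc _; exists (Ordinal lth).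
  by rewrite !inE andbT; apply: (leq_increasing f_inc (Ordinal lth)).
exists (block setT [set i : 'I_b | (h.-1 <= i)%N]); split.
  by rewrite card_block cardsT card_ord card_ord_geq.
apply: coord_prime_sub => f g s _ g_inc; exists ((s^-1)%g (Ordinal lth)).
by rewrite !inE permKV; apply: (leq_increasing g_inc (Ordinal lth)).
Qed.

End Permanental.


Theorem theorem1p1 (K : fieldType) (a b h : nat)
    (charK : 2%N \notin [pchar K]%R)
    (a_gt0 : (0 < a)%N) (b_gt0 : (0 < b)%N) (h_gt0 : (0 < h)%N)
    (h_le_min : (h <= minn a b)%N) (h_lt_max : (h < maxn a b)%N) :
  krull_dim {ideal_quot (permanental_ideal K a b h_gt0)}
    (maxn a b * (h - 1))%N /\
  ideal_height (permanental_ideal K a b h_gt0)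
    (maxn a b * (minn a b - h + 1))%N.
Proof.
have two0 : 2%:R != 0 :> K by move: charK; rewrite inE.
have below (P : prime_idealr {mpoly K[a * b]}) :
    {subset (permanental_ideal K a b h_gt0 : {pred {mpoly K[a * b]}}) <=
            (P : {pred {mpoly K[a * b]}})} ->
    exists m, (a * b - maxn a b * h.-1 <= m)%N /\ chain_ending_at P m.
  by move=> JP; apply/chain_below/permanental_growth.
have abE : (a * b = maxn a b * minn a b)%N.
  by case: (leqP a b) => _; rewrite // mulnC.
have dimE : (maxn a b * (h - 1) = maxn a b * h.-1)%N by rewrite subn1.
have htE : (maxn a b * (minn a b - h + 1) = maxn a b * (minn a b - h.-1))%N.
  by congr (_ * _)%N; lia.
have sumE : (maxn a b * (minn a b - h.-1) + maxn a b * h.-1 = a * b)%N.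
  by rewrite -mulnDr abE subnK //; lia.
have [T [cT JT]] := coord_prime_exists K h_gt0 h_le_min.
have [up [up_ch up0 upT]] := coord_chain K (subsetT T).
have [down [down_ch down0 downT]] := coord_chain K (sub0set T).
have c_up : #|setT :\: T| = (maxn a b * h.-1)%N.
  by rewrite setTD cardsCs setCK card_ord cT -sumE addKn.
have c_down : #|T :\: set0| = (maxn a b * (minn a b - h.-1))%N by rewrite setD0.
rewrite dimE htE; split; split.
(* Adding the remaining variables one by one to [coord_prime T] gives a chain of the required
   length. *)
- rewrite -c_up; rewrite -up0 in JT.
  have [d dch] := quotient_chain up_ch JT.
  by exists (fun i => d i); apply: prime_chain_of_chain.
(* A long chain below the first prime of the lifted chain is put in front of it; the total length is
   at most [a * b]. *)
- move=> n C /chain_of_prime_chain/preim_chain [c [ch Jc]].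
  have [m [lem /chain_ending_atP [d [dch dE]]]] := below _ Jc.
  have := chain_length (chain_cat dch ch dE); lia.
(* The chain [down] bounds the height of this prime from below. Continuing any chain that ends here
   by [up] bounds it from above. *)
- exists (coord_prime K T); split=> //; split.
    by apply/chain_ending_atP; exists down; rewrite -c_down downT.
  move=> m /chain_ending_atP [c [ch cE]].
  rewrite -up0 in cE; have := chain_length (chain_cat ch up_ch cE).
  by rewrite c_up -sumE leq_add2r.
- move=> P m JP [_ maxP]; have [m' [lem' /maxP lem]] := below P JP.
  by apply: leq_trans lem; move: lem'; rewrite -sumE addnK.
Qed.
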